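(* Let $k$ be a field of characteristic zero, and let $X_\bullet\to G$ and $Y_\bullet\to H$ be free simplicial prounipotent resolutions of finite type over $k$. Every morphism $\alpha:G\to H$ of prounipotent groups extends to a simplicial morphism $X_\bullet\to Y_\bullet$ of simplicial prounipotent groups (compatible with the augmentations and $\alpha$). Any two such extensions are simplicially homotopic over $\alpha$, with all components of the homotopy morphisms of prounipotent groups. In particular, two such resolutions of the same group are simplicially homotopy equivalent over that group.
   Context: A prounipotent group over $k$ is an inverse limit of unipotent algebraic groups over $k$ (as an affine group scheme); morphisms are group-scheme morphisms. For a finite set $S$, the free prounipotent group $F_k(S)$ is the exponential of the degree-completed free Lie algebra over $k$ on $S$; its canonical generators are $\exp(e_s)$, $s\in S$, and any assignment $S\to U(k)$, for $U$ prounipotent, extends uniquely to a morphism $F_k(S)\to U$. A free simplicial prounipotent resolution of finite type $X_\bullet\to G$ is a simplicial prounipotent group $X_\bullet$ with an augmentation to a prounipotent group $G$ such that every $X_n$ is a free prounipotent group with a chosen finite free basis, the chosen bases are compatible with degeneracies (degeneracies carry basis elements to basis elements), the augmentation induces $\pi_0X_\bullet\cong G$, and $\pi_nX_\bullet=0$ for all $n>0$. Homotopy groups of a simplicial group are the homology groups of its Moore complex. The components of a simplicial homotopy between simplicial maps $X_\bullet\to Y_\bullet$ are the maps $h_i:X_n\to Y_{n+1}$, $0\le i\le n$, satisfying the usual identities; ''over $\alpha$'' means compatible with the augmentations and $\alpha$. *)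

(* Defs.v *)
From HB Require Import structures.
From mathcomp Require Import all_boot all_order all_fingroup all_algebra.

Set Implicit Arguments.
Unset Strict Implicit.
Unset Printing Implicit Defensive.

Import GRing.Theory.
Local Open Scope ring_scope.

(* Affine group schemes, as representable group-valued functors: [ev] is the  *)
(* natural bijection between R-points and algebra maps [coordAlg -> R], so that  *)
(* [ev p f] is the value of the regular function f at the point p. Since a    *)
(* comAlgType is nonzero, the (one-point) value at the zero algebra is left   *)
(* out. Functoriality of [bc] follows from [ev_bc] and [ev_repr].             *)
Record affineGroup (k : fieldType) := AffineGroup {
  coordAlg : comAlgType k;
  pts : comAlgType k -> groupType;
  bc : forall R R' : comAlgType k,
    {lrmorphism R -> R'} -> {multiplicative pts R -> pts R'};
  ev : forall R : comAlgType k, pts R -> {lrmorphism coordAlg -> R};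
  ev_repr : forall (R : comAlgType k) (u : {lrmorphism coordAlg -> R}),
    exists! p : pts R, ev p =1 u;
  ev_bc : forall (R R' : comAlgType k) (u : {lrmorphism R -> R'}) (p : pts R),
    ev (bc u p) =1 u \o ev p }.

Arguments coordAlg {k}.
Arguments pts {k}.
Arguments bc {k} _ {R R'}.
Arguments ev {k} _ {R}.

Record grpHom (k : fieldType) (G H : affineGroup k) := Hom {
  hom_fun :> forall R : comAlgType k, {multiplicative pts G R -> pts H R};
  hom_nat : forall (R R' : comAlgType k) (u : {lrmorphism R -> R'}) p,
    hom_fun R' (bc G u p) = bc H u (hom_fun R p) }.

Arguments hom_fun {k G H} _ {R}.

Definition hom_id (k : fieldType) (G : affineGroup k) : grpHom G G :=
  @Hom k G G (fun R => (idfun : {multiplicative pts G R -> pts G R}))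
    (fun R R' u p => erefl).

Lemma hom_comp_nat (k : fieldType) (G H K : affineGroup k)
    (g : grpHom H K) (f : grpHom G H) (R R' : comAlgType k)
    (u : {lrmorphism R -> R'}) (p : pts G R) :
  (g R' \o f R') (bc G u p) = bc K u ((g R \o f R) p).
Proof. by rewrite /= !hom_nat. Qed.

Definition hom_comp (k : fieldType) (G H K : affineGroup k)
    (g : grpHom H K) (f : grpHom G H) : grpHom G K :=
  @Hom k G K
    (fun R => (g R \o f R : {multiplicative pts G R -> pts K R}))
    (hom_comp_nat g f).

(* Unipotent algebraic group: closed subgroup of the group of upper           *)
(* unitriangular n x n matrices. M is the generic point of the embedding; it  *)
(* is a closed immersion because the entries of M generate the coordinate     *)
(* algebra.                                                                   *)
Definition unipotent (k : fieldType) (G : affineGroup k) : Prop :=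
  exists (n : nat) (M : 'M[coordAlg G]_n),
    [/\ forall i j : 'I_n, (j < i)%N -> M i j = 0,
        forall i : 'I_n, M i i = 1,
        forall (R : comAlgType k) (p q : pts G R),
          map_mx (ev G (p * q)%g) M = map_mx (ev G p) M *m map_mx (ev G q) M
      & forall B : coordAlg G -> Prop,
          (forall c : k, B c%:A) ->
          (forall f g, B f -> B g -> B (f + g)) ->
          (forall f g, B f -> B g -> B (f * g)) ->
          (forall i j, B (M i j)) ->
          forall f, B f].

(* Inverse limit of an inverse system of unipotent groups over a directed     *)
(* index set; limits of affine group schemes are computed on points.          *)
Definition prounipotent (k : fieldType) (G : affineGroup k) : Prop :=
  exists (I : Type) (le : I -> I -> Prop) (U : I -> affineGroup k)
         (tr : forall i j, le i j -> grpHom (U j) (U i))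
         (pr : forall i, grpHom G (U i)),
    [/\ inhabited I,
        [/\ forall i, le i i,
            forall i j l, le i j -> le j l -> le i l
          & forall i j, exists l, le i l /\ le j l],
        forall i, unipotent (U i),
        [/\ forall i (e : le i i) R (x : pts (U i) R), tr i i e R x = x,
            forall i j l (e : le i j) (e' : le j l) (e'' : le i l) R
                   (x : pts (U l) R), tr i j e R (tr j l e' R x) = tr i l e'' R x
          & forall i j (e : le i j) R (x : pts G R),
              tr i j e R (pr j R x) = pr i R x]
      & forall (R : comAlgType k) (x : forall i, pts (U i) R),
          (forall i j (e : le i j), tr i j e R (x j) = x i) ->
          exists! g : pts G R, forall i, pr i R g = x i].

Record prounipGroup (k : fieldType) := ProunipGroup {
  pu_group :> affineGroup k;
  pu_prounip : prounipotent pu_group }.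

(* Free prounipotent groups. Noncommutative power series in the variables e_s *)
(* are functions on words, and the free Lie algebra is realized as the Lie    *)
(* subalgebra generated by the letters in the free associative algebra.       *)
Section FreeProunipotent.
Variables (k : fieldType) (S : finType) (R : comAlgType k).

Definition series := seq S -> R.

Definition ser_one : series := fun w => if w is [::] then 1 else 0.

Definition ser_letter (s : S) : series :=
  fun w => if w == [:: s] then 1 else 0.

Definition ser_mul (x y : series) : series :=
  fun w => \sum_(i < (size w).+1) x (take i w) * y (drop i w).

Inductive lie_poly : series -> Prop :=
| lie_letter s : lie_poly (ser_letter s)
| lie_zero : lie_poly (fun=> 0)
| lie_add x y : lie_poly x -> lie_poly y -> lie_poly (fun w => x w + y w)
| lie_scale (c : R) x : lie_poly x -> lie_poly (fun w => c * x w)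
| lie_bracket x y : lie_poly x -> lie_poly y ->
    lie_poly (fun w => ser_mul x y w - ser_mul y x w).

Definition ser_comp (d : nat) (x : series) : series :=
  fun w => if size w == d then x w else 0.

(* The degree completion: every homogeneous component is a Lie polynomial.    *)
Definition lie_series (x : series) : Prop :=
  forall d, lie_poly (ser_comp d x).

(* For x without constant term, x^m has no word of length less than m, so     *)
(* the coefficient at w of the exponential series stops at m = size w.        *)
Definition ser_exp (x : series) : series :=
  fun w => \sum_(m < (size w).+1)
    ((m`!)%:R : k)^-1 *: iter m (ser_mul x) ser_one w.

End FreeProunipotent.

(* [b] exhibits G as F_k(S), whose R-points are the exponentials of the Lie   *)
(* series with coefficients in R: there is an isomorphism of group functors   *)
(* from G onto F_k(S) carrying b s to exp(e_s).                               *)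
Definition free_basis (k : fieldType) (G : affineGroup k) (S : finType)
    (b : S -> pts G k^o) : Prop :=
  exists phi : forall R : comAlgType k, pts G R -> series S R,
    [/\ forall R (p q : pts G R), phi R (p * q)%g =1 ser_mul (phi R p) (phi R q),
        forall (R R' : comAlgType k) (u : {lrmorphism R -> R'}) (p : pts G R),
          phi R' (bc G u p) =1 u \o phi R p,
        forall R (p : pts G R),
          exists2 x : series S R, lie_series x & phi R p =1 ser_exp x,
        forall R (x : series S R), lie_series x ->
          exists! p : pts G R, phi R p =1 ser_exp x
      & forall s, phi k^o (b s) =1 ser_exp (@ser_letter k S k^o s)].

(* Faces X_{n+1} -> X_n are [face n i] for i <= n.+1 and degeneracies         *)
(* X_n -> X_{n+1} are [deg n i] for i <= n; other indices carry no meaning    *)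
(* and are never used.                                                        *)
Record simplicialGroup (k : fieldType) := SimplicialGroup {
  obj :> nat -> prounipGroup k;
  face : forall n, nat -> grpHom (obj n.+1) (obj n);
  deg : forall n, nat -> grpHom (obj n) (obj n.+1);
  face_face : forall n i j R (x : pts (obj n.+2) R), (i <= j <= n.+1)%N ->
    face n i R (face n.+1 j.+1 R x) = face n j R (face n.+1 i R x);
  face_deg_lt : forall n i j R (x : pts (obj n.+1) R), (i <= j <= n)%N ->
    face n.+1 i R (deg n.+1 j.+1 R x) = deg n j R (face n i R x);
  face_deg_eq : forall n i R (x : pts (obj n) R), (i <= n)%N ->
    face n i R (deg n i R x) = x;
  face_deg_eqS : forall n i R (x : pts (obj n) R), (i <= n)%N ->
    face n i.+1 R (deg n i R x) = x;
  face_deg_gt : forall n i j R (x : pts (obj n.+1) R), (j < i <= n.+1)%N ->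
    face n.+1 i.+1 R (deg n.+1 j R x) = deg n j R (face n i R x);
  deg_deg : forall n i j R (x : pts (obj n) R), (i <= j <= n)%N ->
    deg n.+1 i R (deg n j R x) = deg n.+1 j.+1 R (deg n i R x) }.

Arguments face {k} _ n i : rename.
Arguments deg {k} _ n i : rename.

(* Subgroup schemes are given by their points. The image of N under f is the  *)
(* closed subgroup scheme of B cut out by the regular functions whose         *)
(* pullback to N vanishes.                                                    *)
Definition closed_image (k : fieldType) (A B : affineGroup k) (f : grpHom A B)
    (N : forall R, pts A R -> Prop) (R : comAlgType k) (y : pts B R) : Prop :=
  forall phi : coordAlg B,
    (forall (R' : comAlgType k) (x : pts A R'), N R' x -> ev B (f R' x) phi = 0) ->
    ev B y phi = 0.

Section Homotopy.
Variables (k : fieldType) (X : simplicialGroup k).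

(* Moore complex: N_n is the intersection of the kernels of d_1, ..., d_n,    *)
(* with differential d_0.                                                     *)
Definition moore (n : nat) : forall R, pts (X n) R -> Prop :=
  match n with
  | 0 => fun R _ => True
  | m.+1 => fun R x => forall i, (0 < i <= m.+1)%N -> face X m i R x = 1%g
  end.

Definition moore_cycle (n : nat) : forall R, pts (X n) R -> Prop :=
  match n with
  | 0 => fun R _ => True
  | m.+1 => fun R x => moore x /\ face X m 0 R x = 1%g
  end.

Definition moore_boundary (n : nat) (R : comAlgType k) (x : pts (X n) R) : Prop :=
  closed_image (face X n 0) (@moore n.+1) x.

(* The quotient of the cycles by the boundaries is trivial.                  *)
Definition trivial_pi (n : nat) : Prop :=
  forall R (x : pts (X n) R), moore_cycle x -> moore_boundary x.

(* q : X_0 -> Q induces an isomorphism of pi_0 with Q: it is a quotient       *)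
(* morphism of affine group schemes, with kernel the boundaries.              *)
Definition presents_pi0 (Q : affineGroup k) (q : grpHom (X 0) Q) : Prop :=
  (forall R (y : pts Q R), closed_image q (@moore_cycle 0) y) /\
  (forall R (x : pts (X 0) R), q R x = 1%g <-> moore_boundary x).

End Homotopy.

Record freeResolution (k : fieldType) (G : prounipGroup k) := FreeResolution {
  res :> simplicialGroup k;
  aug : grpHom (res 0) G;
  aug_face : forall R (x : pts (res 1) R),
    aug R (face res 0 0 R x) = aug R (face res 0 1 R x);
  basis : nat -> finType;
  gen : forall n, basis n -> pts (res n) k^o;
  gen_free : forall n, free_basis (@gen n);
  gen_deg : forall n i (b : basis n), (i <= n)%N ->
    exists b' : basis n.+1, deg res n i k^o (gen b) = gen b';
  pi0_res : presents_pi0 aug;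
  pin_res : forall n, (0 < n)%N -> trivial_pi res n }.

Arguments aug {k G} _.

(* The augmentation X_n -> G, obtained by composing with iterated faces.      *)
Fixpoint augn (k : fieldType) (G : prounipGroup k) (X : freeResolution G)
    (n : nat) : grpHom (X n) G :=
  match n with
  | 0 => aug X
  | m.+1 => hom_comp (augn X m) (face X m 0)
  end.

Record simplicialMap (k : fieldType) (X Y : simplicialGroup k) := SimplicialMap {
  map_at :> forall n, grpHom (X n) (Y n);
  map_face : forall n i R (x : pts (X n.+1) R), (i <= n.+1)%N ->
    map_at n R (face X n i R x) = face Y n i R (map_at n.+1 R x);
  map_deg : forall n i R (x : pts (X n) R), (i <= n)%N ->
    map_at n.+1 R (deg X n i R x) = deg Y n i R (map_at n R x) }.

Definition smap_id (k : fieldType) (X : simplicialGroup k) : simplicialMap X X :=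
  @SimplicialMap k X X (fun n => hom_id (X n))
    (fun n i R x _ => erefl) (fun n i R x _ => erefl).

Lemma smap_comp_face (k : fieldType) (X Y Z : simplicialGroup k)
    (g : simplicialMap Y Z) (f : simplicialMap X Y) n i R
    (x : pts (X n.+1) R) : (i <= n.+1)%N ->
  hom_comp (g n) (f n) R (face X n i R x) =
  face Z n i R (hom_comp (g n.+1) (f n.+1) R x).
Proof. by move=> le_i; rewrite /= !map_face. Qed.

Lemma smap_comp_deg (k : fieldType) (X Y Z : simplicialGroup k)
    (g : simplicialMap Y Z) (f : simplicialMap X Y) n i R
    (x : pts (X n) R) : (i <= n)%N ->
  hom_comp (g n.+1) (f n.+1) R (deg X n i R x) =
  deg Z n i R (hom_comp (g n) (f n) R x).
Proof. by move=> le_i; rewrite /= !map_deg. Qed.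

Definition smap_comp (k : fieldType) (X Y Z : simplicialGroup k)
    (g : simplicialMap Y Z) (f : simplicialMap X Y) : simplicialMap X Z :=
  @SimplicialMap k X Z (fun n => hom_comp (g n) (f n))
    (smap_comp_face g f) (smap_comp_deg g f).

Section Over.
Variables (k : fieldType) (G H : prounipGroup k) (alpha : grpHom G H).
Variables (X : freeResolution G) (Y : freeResolution H).

Definition map_over (f : simplicialMap X Y) : Prop :=
  forall R (x : pts (X 0) R), aug Y R (f 0 R x) = alpha R (aug X R x).

(* The components h n i : X_n -> Y_{n+1} are meaningful for i <= n only.      *)
Definition homotopic_over (f g : simplicialMap X Y) : Prop :=
  exists h : forall n, nat -> grpHom (X n) (Y n.+1),
    [/\ forall n R (x : pts (X n) R), face Y n 0 R (h n 0 R x) = f n R x,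
        forall n R (x : pts (X n) R), face Y n n.+1 R (h n n R x) = g n R x,
        [/\ forall n i j R (x : pts (X n.+1) R), (i <= j <= n)%N ->
              face Y n.+1 i R (h n.+1 j.+1 R x) = h n j R (face X n i R x),
            forall n j R (x : pts (X n) R), (j < n)%N ->
              face Y n j.+1 R (h n j.+1 R x) = face Y n j.+1 R (h n j R x)
          & forall n i j R (x : pts (X n.+1) R), (j < i <= n.+1)%N ->
              face Y n.+1 i.+1 R (h n.+1 j R x) = h n j R (face X n i R x)],
        [/\ forall n i j R (x : pts (X n) R), (i <= j <= n)%N ->
              deg Y n.+1 i R (h n j R x) = h n.+1 j.+1 R (deg X n i R x)
          & forall n i j R (x : pts (X n) R), (j <= i <= n)%N ->
              deg Y n.+1 i.+1 R (h n j R x) = h n.+1 j R (deg X n i R x)]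
      & forall n i R (x : pts (X n) R), (i <= n)%N ->
          augn Y n.+1 R (h n i R x) = alpha R (augn X n R x)].

End Over.

Definition homotopy_equivalent_over (k : fieldType) (G : prounipGroup k)
    (X Y : freeResolution G) : Prop :=
  exists (f : simplicialMap X Y) (g : simplicialMap Y X),
    [/\ map_over (hom_id G) f, map_over (hom_id G) g,
        homotopic_over (hom_id G) (smap_comp g f) (smap_id X)
      & homotopic_over (hom_id G) (smap_comp f g) (smap_id Y)].

(* Main.v *)
(* The standard simplicial argument applies once two facts about prounipotent
   groups over a field k of characteristic zero are known.

   1. Free groups have the universal property. Exponentials of letters generate
   F(R) modulo words of length > d, for all R and d (leading terms of commutators
   are brackets), and a regular function on F only depends on the words of bounded
   length (compare a point with its dilations t^|w| over R[t]). As a polynomial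
   vanishing at all natural numbers is zero, the monoid generated by the basis is
   dense in F. A map e_s |-> log u_s extends to series, with values in unitriangular
   matrices; by density it sends F into the closed subgroup containing the u_s.

   2. A k-point of the closed image of a homomorphism f : N -> H lifts to a k-point
   of N, as soon as N(k) is dense in N. Let A be the algebra of functions on N(k)
   and D a translation-stable subalgebra with a character z. If D <> A, unipotence
   gives f in A but not in D whose translates differ from f by elements of D; in
   characteristic zero f is transcendental over D, so z extends to D[f], and to A by
   Zorn's lemma. For a Moore subgroup density is inherited through the retraction
   of the ambient free group onto it.

   Fact 2 makes the k-points of a resolution an acyclic Kan complex in the naive
   sense, so that spheres can be filled; fact 1 turns the choices made on basis
   elements into homomorphisms, and reduces the simplicial identities to bases. *)
From HB Require Import structures.
From mathcomp Require Import boolp classical_sets functions.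
Require Import Defs.
From mathcomp Require Import all_boot all_order all_fingroup all_algebra.
From mathcomp Require Import zify ring.

Set Implicit Arguments.
Unset Strict Implicit.
Unset Printing Implicit Defensive.

Import GRing.Theory.
Local Open Scope ring_scope.

(** * Points, polynomial algebras *)

(** Closed images are defined by vanishing of functions, so the hypotheses on a resolution say
    nothing directly about k-points, and k need not be algebraically closed. Rational points of
    fibres have to be produced; extending characters takes the place of the usual argument that
    torsors under unipotent groups are trivial in characteristic zero. The other obstacle lies in
    the bases, of which only stability under degeneracies is known. A basis element may be a
    degeneracy in several ways, and its image is then forced several times. Two such expressions
    have a common source one dimension further down, which makes the forced values agree; only the
    remaining basis elements leave a choice. For homotopies the forced values are those of the
    degeneracies in the path object of Y, and the components at one simplex have to be filled in
    order, since each shares a face with its predecessor. *)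

Section AlgebraMorphisms.
Variables (k : fieldType) (A B : comAlgType k) (f : A -> B).
Hypotheses (fD : {morph f : x y / x + y}) (fM : {morph f : x y / x * y}).
Hypothesis fC : forall c : k, f c%:A = c%:A.

Let fB : zmod_morphism f.
Proof.
move=> x y; apply: (addIr (f y)); rewrite -fD !subrK //.
Qed.

Let f1M : monoid_morphism f.
Proof. by split=> //; have := fC 1; rewrite !scale1r. Qed.

Let fZ : scalable f.
Proof. by move=> c x /=; rewrite -mulr_algl fM fC mulr_algl. Qed.

Lemma alg_morph : {g : {lrmorphism A -> B} | g =1 f}.
Proof.
pose g : {lrmorphism A -> B} := HB.pack f (GRing.isZmodMorphism.Build A B f fB)
    (GRing.isMonoidMorphism.Build A B f f1M)
    (GRing.isScalable.Build k A B *:%R f fZ).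
by exists g.
Qed.

End AlgebraMorphisms.

Lemma alg_morphC (k : fieldType) (A B : comAlgType k) (f : {lrmorphism A -> B})
  (c : k) : f c%:A = c%:A.
Proof. by rewrite linearZ rmorph1. Qed.

Section ScalarEmbedding.
Variables (k : fieldType) (A : comAlgType k).

Lemma scalar_lr_subproof :
  {f : {lrmorphism k^o -> A} | forall c, f c = (c : k)%:A}.
Proof.
apply: (@alg_morph k k^o A (fun c : k^o => (c : k)%:A)).
- by move=> x y; rewrite scalerDl.
- by move=> x y; rewrite -scalerAl mul1r scalerA.
- by move=> c; rewrite /GRing.scale /= mulr1.
Qed.

Definition scalar_lr := sval scalar_lr_subproof.

Lemma scalar_lrE (c : k) : scalar_lr c = c%:A.
Proof. exact: (svalP scalar_lr_subproof). Qed.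

End ScalarEmbedding.

(* Polynomials over R, as an algebra over k rather than over R. *)
Section PolyAlgebra.
Variables (k : fieldType) (R : comAlgType k).

Definition polyAlg : Type := {poly R}.
HB.instance Definition _ := GRing.ComNzRing.on polyAlg.

Definition polyAlg_scale (c : k) (p : polyAlg) : polyAlg :=
  (c%:A : R) *: (p : {poly R}).

Fact polyAlg_scaleA a b p :
  polyAlg_scale a (polyAlg_scale b p) = polyAlg_scale (a * b) p.
Proof. by rewrite /polyAlg_scale scalerA -scalerAl mul1r scalerA. Qed.

Fact polyAlg_scale1 : left_id 1 polyAlg_scale.
Proof. by move=> p; rewrite /polyAlg_scale !scale1r. Qed.

Fact polyAlg_scaleDr : right_distributive polyAlg_scale +%R.
Proof. by move=> a p q; rewrite /polyAlg_scale scalerDr. Qed.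

Fact polyAlg_scaleDl p : {morph polyAlg_scale^~ p : a b / a + b}.
Proof. by move=> a b; rewrite /polyAlg_scale !scalerDl. Qed.

HB.instance Definition _ := GRing.Zmodule_isLmodule.Build k polyAlg
  polyAlg_scaleA polyAlg_scale1 polyAlg_scaleDr polyAlg_scaleDl.

Fact polyAlg_scaleAl (c : k) (p q : polyAlg) : c *: (p * q) = c *: p * q.
Proof. exact: (scalerAl (c%:A : R) (p : {poly R}) (q : {poly R})). Qed.

HB.instance Definition _ :=
  GRing.Lmodule_isLalgebra.Build k polyAlg polyAlg_scaleAl.

Fact polyAlg_scaleAr (c : k) (p q : polyAlg) : c *: (p * q) = p * (c *: q).
Proof. exact: (scalerAr (c%:A : R) (p : {poly R}) (q : {poly R})). Qed.

HB.instance Definition _ :=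
  GRing.Lalgebra_isAlgebra.Build k polyAlg polyAlg_scaleAr.

End PolyAlgebra.

Section PolyEval.
Variables (k : fieldType) (R R' : comAlgType k) (u : {lrmorphism R -> R'}).

Lemma polyAlgC (c : k) : (c%:A : polyAlg R) = ((c%:A : R)%:P : {poly R}).
Proof.
by rewrite /GRing.scale /= /polyAlg_scale alg_polyC.
Qed.

Lemma polyAlg_eval_subproof (a : R') : {f : {lrmorphism polyAlg R -> R'} |
  forall p, f p = (map_poly u (p : {poly R})).[a]}.
Proof.
apply: (@alg_morph k (polyAlg R) R' (fun p => (map_poly u (p : {poly R})).[a])).
- by move=> p q; rewrite rmorphD hornerD.
- by move=> p q; rewrite rmorphM hornerM.
- by move=> c; rewrite polyAlgC map_polyC hornerC; exact: alg_morphC.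
Qed.

Definition polyAlg_eval (a : R') := sval (polyAlg_eval_subproof a).

Lemma polyAlg_evalE a p : polyAlg_eval a p = (map_poly u (p : {poly R})).[a].
Proof. exact: (svalP (polyAlg_eval_subproof a)). Qed.

End PolyEval.

Lemma polyAlg_const_subproof (k : fieldType) (R : comAlgType k) :
  {f : {lrmorphism R -> polyAlg R} | forall c, f c = (c%:P : {poly R})}.
Proof.
apply: (@alg_morph k R (polyAlg R) (fun c => (c%:P : {poly R}))).
- by move=> p q; rewrite rmorphD.
- by move=> p q; rewrite rmorphM.
- by move=> c; rewrite polyAlgC.
Qed.

Definition polyAlg_const (k : fieldType) (R : comAlgType k) :=
  sval (@polyAlg_const_subproof k R).

Lemma polyAlg_constE (k : fieldType) (R : comAlgType k) (c : R) :
  polyAlg_const R c = (c%:P : {poly R}).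
Proof. exact: (svalP (polyAlg_const_subproof R)). Qed.

Definition comp_lr (k : fieldType) (A B C : comAlgType k)
  (g : {lrmorphism B -> C}) (f : {lrmorphism A -> B}) : {lrmorphism A -> C} :=
  g \o f.

Definition polyAlg_map (k : fieldType) (R R' : comAlgType k)
    (u : {lrmorphism R -> R'}) : {lrmorphism polyAlg R -> polyAlg R'} :=
  polyAlg_eval (comp_lr (polyAlg_const R') u) ('X : {poly R'}).

Lemma polyAlg_mapE (k : fieldType) (R R' : comAlgType k)
    (u : {lrmorphism R -> R'}) (p : polyAlg R) :
  polyAlg_map u p = map_poly u (p : {poly R}) :> {poly R'}.
Proof.
rewrite /polyAlg_map polyAlg_evalE.
rewrite -[RHS](comp_polyXr (map_poly u (p : {poly R}))) /comp_poly.
rewrite -map_poly_comp; congr (_.['X]).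
by apply: eq_map_poly => c; rewrite /= polyAlg_constE.
Qed.

Lemma char0_natr_neq0 (k : fieldType) : [pchar k] =i pred0 ->
  forall n : nat, (n.+1%:R : k) != 0.
Proof. by move=> /pcharf0P k0 n; rewrite k0. Qed.

Lemma char0_regular (k : fieldType) (R : lmodType k) (n : nat) (x : R) :
  [pchar k] =i pred0 -> x *+ n.+1 = 0 -> x = 0.
Proof.
move=> k0; rewrite -scaler_nat => /(congr1 (fun x => (n.+1%:R : k)^-1 *: x)).
by rewrite scalerA mulVf ?char0_natr_neq0 // scale1r scaler0.
Qed.

(** Since R may have zero divisors, roots cannot just be counted. After division by X - m, the
    factors n - m for n > m are nonzero integers, hence regular; the bound m moves up with each
    division. *)
Lemma poly_vanish_nat (k : fieldType) (R : comAlgType k) (p : {poly R}) m :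
  [pchar k] =i pred0 -> (forall n, (m <= n)%N -> p.[n%:R] = 0) -> p = 0.
Proof.
move=> k0; have [d] := ubnP (size p); elim: d p m => // d IHd p m le_pd p0.
have [->//|p_nz] := eqVneq p 0.
have /factor_theorem[q Dp] : root p m%:R by apply/eqP; exact: p0.
rewrite Dp; suff -> : q = 0 by rewrite mul0r.
apply: (IHd q m.+1) => [|n lt_mn].
  have q_nz : q != 0 by apply: contraNneq p_nz => q0; rewrite Dp q0 mul0r.
  have := le_pd; rewrite Dp size_Mmonic ?monicXsubC // size_XsubC addn2 /=.
  by rewrite ltnS.
apply: (@char0_regular k _ (n - m.+1)) => //.
have := p0 n (ltnW lt_mn).
by rewrite Dp hornerM hornerXsubC -natrB ?(ltnW lt_mn) // mulr_natr -subSn.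
Qed.

Lemma multiplicative1 (G H : groupType) (f : {multiplicative G -> H}) :
  f 1%g = 1%g.
Proof. by apply: (mulgI (f 1%g)); rewrite -gmulfM !mulg1. Qed.

Lemma multiplicativeV (G H : groupType) (f : {multiplicative G -> H}) x :
  f (x^-1)%g = ((f x)^-1)%g.
Proof. by apply: (mulgI (f x)); rewrite -gmulfM !mulgV multiplicative1. Qed.

Section Points.
Variables (k : fieldType) (G : affineGroup k).

Lemma ev_inj (R : comAlgType k) (p q : pts G R) : ev G p =1 ev G q -> p = q.
Proof.
move=> pq; have [r [_ r_uniq]] := ev_repr (ev G q).
by rewrite -(r_uniq p) // (r_uniq q).
Qed.

Lemma pt_of (R : comAlgType k) (u : {lrmorphism coordAlg G -> R}) :
  {p : pts G R | ev G p =1 u}.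
Proof. by apply: cid; have [p [up _]] := ev_repr u; exists p. Qed.

Lemma ev_bcE (R R' : comAlgType k) (u : {lrmorphism R -> R'}) (p : pts G R) f :
  ev G (bc G u p) f = u (ev G p f).
Proof. exact: ev_bc. Qed.

(** By Yoneda every R-point is a base change of this one, so a natural construction is determined by
    what it does here. *)
Definition univ : pts G (coordAlg G) := sval (pt_of idfun).

Lemma ev_univ f : ev G univ f = f.
Proof. exact: (svalP (pt_of idfun)). Qed.

Lemma bc_univ (R : comAlgType k) (p : pts G R) : bc G (ev G p) univ = p.
Proof. by apply: ev_inj => f; rewrite ev_bc /= ev_univ. Qed.

Lemma bc_eq (R R' : comAlgType k) (u v : {lrmorphism R -> R'}) p :
  u =1 v -> bc G u p = bc G v p.
Proof. by move=> uv; apply: ev_inj => f; rewrite !ev_bc /= uv. Qed.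

Lemma bc_id (R : comAlgType k) (u : {lrmorphism R -> R}) p :
  u =1 id -> bc G u p = p.
Proof. by move=> uv; apply: ev_inj => f; rewrite !ev_bc /= uv. Qed.

Lemma bc_bc (R R' R'' : comAlgType k) (v : {lrmorphism R' -> R''})
  (u : {lrmorphism R -> R'}) p : bc G v (bc G u p) = bc G (comp_lr v u) p.
Proof. by apply: ev_inj => f; rewrite !ev_bc /= ev_bc. Qed.

End Points.

Section Pullback.
Variables (k : fieldType) (G H : affineGroup k).

Lemma pullback_subproof (f : grpHom G H) :
  {g : {lrmorphism coordAlg H -> coordAlg G} |
    forall (R : comAlgType k) (p : pts G R) a, ev H (f R p) a = ev G p (g a)}.
Proof.
by exists (ev H (f _ (univ G))) => R p a; rewrite -{1}(bc_univ p) hom_nat ev_bc.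
Qed.

Definition pullback f := sval (pullback_subproof f).

Lemma ev_hom (f : grpHom G H) (R : comAlgType k) (p : pts G R) a :
  ev H (f R p) a = ev G p (pullback f a).
Proof. exact: (svalP (pullback_subproof f)). Qed.

Lemma nat_of_pt_nat (g : pts H (coordAlg G)) (R R' : comAlgType k)
  (u : {lrmorphism R -> R'}) (p : pts G R) :
  bc H (ev G (bc G u p)) g = bc H u (bc H (ev G p) g).
Proof. by rewrite bc_bc; apply: bc_eq => f; rewrite ev_bc. Qed.

Definition hom_of_pt (g : pts H (coordAlg G))
    (gM : forall (R : comAlgType k) (p q : pts G R),
      bc H (ev G (p * q)%g) g = (bc H (ev G p) g * bc H (ev G q) g)%g) :
  grpHom G H :=
  @Defs.Hom k G H
    (fun R => HB.pack (fun p : pts G R => bc H (ev G p) g)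
       (isMultiplicative.Build (pts G R) (pts H R) _ (gM R)))
    (nat_of_pt_nat g).

End Pullback.

(* An alias of [series], whose product is [ser_mul] and not the pointwise product
   that functions inherit from the library. *)
Section SeriesRing.
Variables (k : fieldType) (S : finType) (R : comAlgType k).

Definition ncseries : Type := series S R.

HB.instance Definition _ := gen_eqMixin ncseries.
HB.instance Definition _ := gen_choiceMixin ncseries.

Implicit Types x y z : ncseries.

Let addx x y : ncseries := fun w => x w + y w.
Let oppx x : ncseries := fun w => - x w.

Fact ncs_addA : associative addx.
Proof. by move=> x y z; apply/funext=> w; rewrite /addx addrA. Qed.
Fact ncs_addC : commutative addx.
Proof. by move=> x y; apply/funext=> w; rewrite /addx addrC. Qed.
Fact ncs_add0 : left_id (fun=> 0) addx.
Proof. by move=> x; apply/funext=> w; rewrite /addx add0r. Qed.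
Fact ncs_addN : left_inverse (fun=> 0) oppx addx.
Proof. by move=> x; apply/funext=> w; rewrite /addx addNr. Qed.

HB.instance Definition _ := GRing.isZmodule.Build ncseries
  ncs_addA ncs_addC ncs_add0 ncs_addN.

Let mulx : ncseries -> ncseries -> ncseries := @ser_mul k S R.
Let onex : ncseries := @ser_one k S R.

Lemma ser_mul_nil x y : mulx x y [::] = x [::] * y [::].
Proof. by rewrite /mulx /ser_mul big_ord_recl big_ord0 addr0. Qed.

Lemma ser_mul_cons x y s w :
  mulx x y (s :: w) = x [::] * y (s :: w) + mulx (fun v => x (s :: v)) y w.
Proof. by rewrite /mulx /ser_mul big_ord_recl. Qed.

Fact ncs_mul1 : left_id onex mulx.
Proof.
move=> x; apply/funext=> [[|s w]].
  by rewrite ser_mul_nil /= mul1r.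
rewrite ser_mul_cons mul1r /mulx /ser_mul big1 ?addr0 // => i _.
by rewrite mul0r.
Qed.

Fact ncs_1mul : right_id onex mulx.
Proof.
move=> x; apply/funext=> w; elim: w x => [|s w IHw] x.
  by rewrite ser_mul_nil /= mulr1.
by rewrite ser_mul_cons IHw mulr0 add0r.
Qed.

Fact ncs_mulDl : left_distributive mulx +%R.
Proof.
move=> x y z; apply/funext=> w; rewrite /mulx /ser_mul /= -[RHS]big_split /=.
by apply: eq_bigr => i _; rewrite [(x + y) _]/= mulrDl.
Qed.

Fact ncs_mulDr : right_distributive mulx +%R.
Proof.
move=> x y z; apply/funext=> w; rewrite /mulx /ser_mul /= -[RHS]big_split /=.
by apply: eq_bigr => i _; rewrite mulrDr.
Qed.

Fact ncs_mulA : associative mulx.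
Proof.
move=> x y z; apply/funext=> w; elim: w x => [|s w IHw] x.
  by rewrite !ser_mul_nil mulrA.
rewrite !(ser_mul_cons, ser_mul_nil) IHw mulrDr -addrA mulrA; congr (_ + _).
have -> : (fun v => mulx x y (s :: v)) =
    (fun v => x [::] * y (s :: v)) + mulx (fun v => x (s :: v)) y :> ncseries.
  by apply/funext=> v; rewrite ser_mul_cons.
rewrite ncs_mulDl; congr (_ + _).
rewrite /mulx /ser_mul big_distrr /=; apply: eq_bigr => i _.
by rewrite mulrA.
Qed.

Fact ncs_1neq0 : onex != 0 :> ncseries.
Proof.
apply/eqP=> /(congr1 (fun x : ncseries => x [::])) /eqP.
by rewrite oner_eq0.
Qed.

HB.instance Definition _ := GRing.Zmodule_isNzRing.Build ncseries
  ncs_mulA ncs_mul1 ncs_1mul ncs_mulDl ncs_mulDr ncs_1neq0.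

Let scalex (c : R) x : ncseries := fun w => c * x w.
Fact ncs_scaleA a b x : scalex a (scalex b x) = scalex (a * b) x.
Proof. by apply/funext=> w; rewrite /scalex mulrA. Qed.
Fact ncs_scale1 : left_id 1 scalex.
Proof. by move=> x; apply/funext=> w; rewrite /scalex mul1r. Qed.
Fact ncs_scaleDr : right_distributive scalex +%R.
Proof. by move=> c x y; apply/funext=> w; rewrite /scalex mulrDr. Qed.
Fact ncs_scaleDl x : {morph scalex^~ x : a b / a + b}.
Proof. by move=> a b; apply/funext=> w; rewrite /scalex mulrDl. Qed.
HB.instance Definition _ := GRing.Zmodule_isLmodule.Build R ncseries
  ncs_scaleA ncs_scale1 ncs_scaleDr ncs_scaleDl.

Fact ncs_scaleAl (c : R) x y : c *: (x * y) = c *: x * y.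
Proof.
apply/funext=> w; rewrite [LHS]big_distrr /=; apply: eq_bigr => i _.
by rewrite mulrA.
Qed.
HB.instance Definition _ := GRing.Lmodule_isLalgebra.Build R ncseries ncs_scaleAl.
Fact ncs_scaleAr (c : R) x y : c *: (x * y) = x * (c *: y).
Proof.
apply/funext=> w; rewrite [LHS]big_distrr /=; apply: eq_bigr => i _.
by rewrite mulrCA.
Qed.
HB.instance Definition _ := GRing.Lalgebra_isAlgebra.Build R ncseries ncs_scaleAr.

Lemma ncsD x y w : (x + y) w = x w + y w. Proof. by []. Qed.
Lemma ncsN x w : (- x) w = - x w. Proof. by []. Qed.
Lemma ncsZ (c : R) x w : (c *: x) w = c * x w. Proof. by []. Qed.
Lemma ncs1 w : (1 : ncseries) w = @ser_one k S R w. Proof. by []. Qed.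
Lemma ncsM x y : x * y = ser_mul x y. Proof. by []. Qed.

Lemma ncsX x m : x ^+ m = iter m (ser_mul x) (@ser_one k S R).
Proof. by elim: m => [|m IHm] //; rewrite exprS /= -IHm. Qed.

Lemma ser_expE x w :
  ser_exp x w = \sum_(m < (size w).+1) ((m`!)%:R : k)^-1 *: (x ^+ m) w.
Proof. by apply: eq_bigr => m _; rewrite ncsX. Qed.

Definition ord_ge (d : nat) x := forall w, (size w < d)%N -> x w = 0.

Lemma ord_ge_zero d : ord_ge d 0. Proof. by []. Qed.

Lemma ord_geD d x y : ord_ge d x -> ord_ge d y -> ord_ge d (x + y).
Proof. by move=> dx dy w lt_wd; rewrite ncsD dx ?dy ?addr0. Qed.

Lemma ord_geN d x : ord_ge d x -> ord_ge d (- x).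
Proof. by move=> dx w lt_wd; rewrite ncsN dx ?oppr0. Qed.

Lemma ord_geB d x y : ord_ge d x -> ord_ge d y -> ord_ge d (x - y).
Proof. by move=> dx dy; apply: ord_geD => //; apply: ord_geN. Qed.

Lemma ord_geM a b x y : ord_ge a x -> ord_ge b y -> ord_ge (a + b) (x * y).
Proof.
move=> ax yb w lt_w; rewrite ncsM /ser_mul big1 // => i _.
have [lt_ia|le_ai] := ltnP i a.
  rewrite ax ?mul0r // size_take; case: (ltnP i (size w)) => // le_wi; lia.
rewrite yb ?mulr0 // size_drop; have := ltn_ord i; lia.
Qed.

Lemma ord_ge_le a b x : (a <= b)%N -> ord_ge b x -> ord_ge a x.
Proof. by move=> le_ab bx w lt_wa; apply: bx; apply: leq_trans le_ab. Qed.

Lemma ord_geX a x m : ord_ge a x -> ord_ge (m * a) (x ^+ m).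
Proof.
move=> ax; elim: m => [|m IHm] //; rewrite exprS mulSn; exact: ord_geM.
Qed.

(** The powers x^m with m >= 2 start in degree 2d, which exceeds d because d > 0. *)
Lemma ser_exp_lead d x : (0 < d)%N -> ord_ge d x ->
  ord_ge d.+1 ((ser_exp x : ncseries) - 1 - x).
Proof.
move=> d_gt0 dx w lt_wd; rewrite !ncsD !ncsN ser_expE.
rewrite big_ord_recl fact0 invr1 scale1r expr0.
rewrite [X in X - x w]addrAC subrr add0r.
case: w lt_wd => [|s w] lt_wd; first by rewrite big_ord0 dx ?subrr.
rewrite big_ord_recl /= factS fact0 invr1 scale1r expr1 addrC addKr.
rewrite big1 // => i _; rewrite (@ord_geX d _ _ dx) ?scaler0 //=.
rewrite /bump /=; move: lt_wd => /=; nia.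
Qed.

(** The order of x is raised one degree at a time: once x has order d > 0, it agrees with its
    exponential minus 1 up to degree d by [ser_exp_lead]. *)
Lemma ser_exp_ord_ge d x : x [::] = 0 ->
  ord_ge d ((ser_exp x : ncseries) - 1) -> ord_ge d x.
Proof.
move=> x0 dx; elim: d dx => [|d IHd] dx //.
have {}IHd := IHd (ord_ge_le (leqnSn d) dx).
case: d => [|d] in dx IHd *; first by case.
have := ord_geB dx (ser_exp_lead (ltn0Sn d) IHd).
by rewrite opprB addrC subrK.
Qed.

End SeriesRing.

(** * Lie series *)

Section LieSeries.
Variables (k : fieldType) (S : finType).

Lemma lie_poly_nil (R : comAlgType k) (x : series S R) : lie_poly x -> x [::] = 0.
Proof.
elim=> {x} [s|//|x y _ x0 _ y0|c x _ x0|x y _ x0 _ y0] //=.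
- by rewrite x0 y0 addr0.
- by rewrite x0 mulr0.
- by rewrite !(@ser_mul_nil k S R) x0 y0 mulr0 subrr.
Qed.

Lemma lie_series_nil (R : comAlgType k) (x : series S R) :
  lie_series x -> x [::] = 0.
Proof. by move=> /(_ 0%N) /lie_poly_nil. Qed.

Lemma lie_series0 (R : comAlgType k) : lie_series ((fun=> 0) : series S R).
Proof.
move=> d; suff -> : ser_comp d (fun=> 0) = ((fun=> 0) : series S R).
  exact: lie_zero.
by apply/funext=> w; rewrite /ser_comp; case: ifP.
Qed.

Section BaseChange.
Variables (R R' : comAlgType k) (u : {lrmorphism R -> R'}).

Lemma ser_mul_morph (x y : series S R) w :
  u (ser_mul x y w) = ser_mul (fun v => u (x v)) (fun v => u (y v)) w.
Proof. by rewrite rmorph_sum; apply: eq_bigr => i _; rewrite rmorphM. Qed.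

Lemma lie_poly_morph (x : series S R) :
  lie_poly x -> lie_poly (fun w => u (x w)).
Proof.
elim=> {x} [s||x y _ ux _ uy|c x _ ux|x y _ ux _ uy].
- rewrite (_ : (fun w => _) = @ser_letter k S R' s); first exact: lie_letter.
  by apply/funext=> w; rewrite /ser_letter; case: ifP; rewrite (rmorph1, rmorph0).
- rewrite (_ : (fun w => _) = fun=> 0); first exact: lie_zero.
  by apply/funext=> w; rewrite rmorph0.
- rewrite (_ : (fun w => _) = fun w => u (x w) + u (y w)); first exact: lie_add.
  by apply/funext=> w; rewrite rmorphD.
- rewrite (_ : (fun w => _) = fun w => u c * u (x w)); first exact: lie_scale.
  by apply/funext=> w; rewrite rmorphM.
- have := lie_bracket ux uy; congr lie_poly; apply/funext=> w.
  by rewrite rmorphB /= !ser_mul_morph.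
Qed.

(** The weights are arbitrary, not powers of a scalar: being a Lie series is tested degree by
    degree, so it survives any weights, and [finite_determination] uses weights that are not
    multiplicative. *)
Definition ser_weigh (a : nat -> R') (x : series S R) : series S R' :=
  fun w => a (size w) * u (x w).

Lemma lie_series_weigh a x : lie_series x -> lie_series (ser_weigh a x).
Proof.
move=> x_lie d; have := lie_scale (a d) (lie_poly_morph (x_lie d)).
congr lie_poly; apply/funext=> w; rewrite /ser_comp /ser_weigh.
by case: eqP => [<-|_] //; rewrite rmorph0 mulr0.
Qed.

Variable t : R'.
Definition dilate (x : ncseries S R) : ncseries S R' :=
  ser_weigh (fun n => t ^+ n) x.

Lemma dilate1 : dilate 1 = 1.
Proof.
apply/funext=> [[|s w]].
  by rewrite /dilate /ser_weigh /= expr0 mul1r rmorph1.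
by rewrite /dilate /ser_weigh /= rmorph0 mulr0.
Qed.

Lemma dilateM x y : dilate (x * y) = dilate x * dilate y.
Proof.
apply/funext=> w; rewrite /dilate /ser_weigh ser_mul_morph big_distrr /=.
apply: eq_bigr => i _; rewrite mulrACA -exprD size_take size_drop.
congr (t ^+ _ * _); have := ltn_ord i.
by case: (ltnP i (size w)) => ? ?; lia.
Qed.

Lemma dilateX x m : dilate (x ^+ m) = dilate x ^+ m.
Proof. by elim: m => [|m IHm]; rewrite ?dilate1 // !exprS dilateM IHm. Qed.

Lemma dilate_exp (x : series S R) : dilate (ser_exp x) = ser_exp (dilate x).
Proof.
apply/funext=> w; rewrite ser_expE /dilate /ser_weigh ser_expE.
rewrite rmorph_sum big_distrr /=; apply: eq_bigr => m _.
by rewrite linearZ -dilateX scalerAr.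
Qed.

End BaseChange.

Lemma ser_exp_morph (R R' : comAlgType k) (u : {lrmorphism R -> R'})
    (x : series S R) :
  (fun w => u (ser_exp x w)) = ser_exp (fun w => u (x w)) :> ncseries S R'.
Proof.
have := dilate_exp u 1 x; rewrite /dilate /ser_weigh => E.
transitivity (fun w => 1 ^+ size w * u (ser_exp x w)).
  by apply/funext=> w; rewrite expr1n mul1r.
rewrite E; congr ser_exp; apply/funext=> w.
by rewrite expr1n mul1r.
Qed.

Lemma ser_exp0 (R : comAlgType k) : ser_exp (fun=> 0) = 1 :> ncseries S R.
Proof.
apply/funext=> w; rewrite ser_expE big_ord_recl big1 /= => [|i _].
  by rewrite fact0 invr1 scale1r addr0.
by rewrite -[(fun=> 0)]/(0 : ncseries S R) exprS mul0r scaler0.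
Qed.

Section Letters.
Variable R : comAlgType k.

Definition letter_ser (s : S) (a : R) : series S R := fun w => a * @ser_letter k S R s w.

Lemma lie_letter_ser s a : lie_series (letter_ser s a).
Proof.
move=> d; have [->|d1] := eqVneq d 1%N.
  have := lie_scale a (@lie_letter k S R s); congr lie_poly; apply/funext=> w.
  rewrite /ser_comp /letter_ser /ser_letter.
  by case: (w =P [:: s]) => [->|] //; rewrite mulr0 if_same.
have := @lie_zero k S R; congr lie_poly; apply/funext=> w.
rewrite /ser_comp /letter_ser /ser_letter.
case: eqP => // sz_w; case: eqP => // Dw; first by rewrite Dw in sz_w; rewrite -sz_w in d1.
by rewrite mulr0.
Qed.

Lemma letter_serX s a m w :
  ((letter_ser s a : ncseries S R) ^+ m) w = if w == nseq m s then a ^+ m else 0.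
Proof.
elim: m w => [|m IHm] w; first by case: w.
rewrite exprS; case: w => [|t w].
  by rewrite ncsM ser_mul_nil /letter_ser mulr0 mul0r.
rewrite ncsM ser_mul_cons [X in X * _]/letter_ser mulr0 mul0r add0r.
rewrite (_ : (fun v => _) = (if t == s then a else 0) *: (1 : ncseries S R)).
  rewrite -ncsM -scalerAl mul1r ncsZ IHm /= eqseq_cons.
  by case: eqP => _; rewrite ?mul0r //=; case: eqP => _; rewrite ?mulr0 // exprS.
apply/funext=> v; rewrite ncsZ ncs1 /letter_ser /ser_letter eqseq_cons.
by case: v => [|? ?]; case: eqP => //= _; rewrite ?mulr0 ?mulr1 ?mul0r.
Qed.

Lemma letter_exp s a w : ser_exp (letter_ser s a) w =
  if w == nseq (size w) s then (((size w)`!)%:R : k)^-1 *: a ^+ size w else 0.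
Proof.
rewrite ser_expE big_ord_recr /= letter_serX big1 ?add0r => [|i _].
  by case: eqP => // _; rewrite scaler0.
rewrite letter_serX; case: eqP => [Dw|_]; last by rewrite scaler0.
by have := ltn_ord i; rewrite {2}Dw size_nseq ltnn.
Qed.

(** At the word s^n this is the binomial theorem divided by n!. At other words both sides vanish, as
    a word cut into two powers of s is itself a power of s. *)
Lemma letter_expD s a b : [pchar k] =i pred0 ->
  ser_exp (letter_ser s (a + b)) =
  (ser_exp (letter_ser s a) : ncseries S R) * ser_exp (letter_ser s b).
Proof.
move=> k0; apply/funext=> w; rewrite letter_exp ncsM /ser_mul.
case: eqP => Dw.
  rewrite addrC exprDn scaler_sumr; apply: eq_bigr => i _.
  rewrite !letter_exp size_drop size_takel; last by rewrite -ltnS.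
  have [-> ->] : take i w = nseq i s /\ drop i w = nseq (size w - i) s.
    have le_iw : (i <= size w)%N by rewrite -ltnS.
    by move: (nat_of_ord i) le_iw => j le_jw; rewrite {1 2}Dw take_nseq ?drop_nseq.
  rewrite !eqxx.
  rewrite -scaler_nat scalerA -scalerAl -scalerAr scalerA [b ^+ _ * _]mulrC.
  congr (_ *: _); have le_iw : (i <= size w)%N by rewrite -ltnS.
  have natr_nz n : (0 < n)%N -> (n%:R : k) != 0.
    by case: n => // n _; exact: char0_natr_neq0.
  rewrite -(bin_fact le_iw) !natrM; field; by rewrite !natr_nz ?fact_gt0 ?bin_gt0.
rewrite big1 // => i _; rewrite !letter_exp.
case: eqP => // Dt; last by rewrite mul0r.
case: eqP => // Dd; last by rewrite mulr0.
case: Dw; rewrite -{1}(cat_take_drop i w) Dt Dd -nseqD.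
by rewrite -size_cat cat_take_drop.
Qed.

End Letters.

End LieSeries.

(** * Density of the monoid generated by a free basis *)

Lemma quasi_mul (A : nzRingType) (p q x y : A) :
  p * q - 1 - (x + y) = (p - 1 - x) + (q - 1 - y) + (p - 1) * (q - 1).
Proof.
rewrite -{1}[p](subrK 1) -{1}[q](subrK 1); move: (p - 1) (q - 1) => U V.
rewrite mulrDl !mulrDr mulr1 !mul1r [_ + (V + 1)]addrA addrK.
by rewrite [in RHS]addrACA -opprD [RHS]addrAC -[U * V + U + V]addrA [U * V + _]addrC.
Qed.

Lemma quasi_comm (A : nzRingType) (p q : A) :
  p * q - q * p = (p - 1) * (q - 1) - (q - 1) * (p - 1).
Proof.
rewrite -{1 2}[p](subrK 1) -{1 2}[q](subrK 1); move: (p - 1) (q - 1) => U V.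
have expand (a c : A) : (a + 1) * (c + 1) = a * c + (a + c + 1).
  by rewrite mulrDl !mulrDr mulr1 !mul1r !addrA.
by rewrite !expand [V + U]addrC opprD addrACA subrr addr0.
Qed.

(** Error term of a group commutator: for U = p - 1, V = q - 1 and K the inverse of qp, the product
    (UV - VU)K is the commutator minus 1. If x and y are the leading terms of U and V, every summand
    on the right has higher order than the bracket of x and y. *)
Lemma comm_approx (A : nzRingType) (U V x y K : A) :
  (U * V - V * U) * K - (x * y - y * x) =
  (U * V - V * U) * (K - 1) + (((U - x) * V + x * (V - y)) -
    ((V - y) * U + y * (U - x))).
Proof.
have sub_mul (a c d e : A) : (a - d) * c + d * (c - e) = a * c - d * e.
  by rewrite mulrBl mulrBr addrA subrK.
rewrite !sub_mul mulrBr mulr1.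
have -> (a c d e : A) : (a - c) - (d - e) = (a - d) - (c - e).
  by rewrite !opprB [e - d]addrC addrACA [- c + e]addrC.
by rewrite addrA subrK.
Qed.

Lemma ser_compM (k : fieldType) (S : finType) (R : comAlgType k)
    (x y : ncseries S R) d :
  ser_comp d (ser_mul x y) =
  \sum_(i < d.+1) (ser_comp i x : ncseries S R) * ser_comp (d - i) y.
Proof.
apply/funext=> w.
pose evw (z : ncseries S R) := z w.
have evwD : {morph evw : u v / u + v} by [].
rewrite -[RHS]/(evw _) (big_morph evw evwD (erefl : evw 0 = 0)).
rewrite /evw /ser_comp; case: (size w =P d) => [<-|/eqP sz_w].
  under eq_bigr => i _.
    rewrite ncsM /ser_mul (bigD1 i) //= size_drop size_takel -1?ltnS // !eqxx.
    rewrite big1 ?addr0 => [|j ne_ji]; last first.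
      by rewrite size_takel -1?ltnS // (inj_eq val_inj) (negPf ne_ji) mul0r.
    over.
  by [].
rewrite big1 // => i _; rewrite ncsM /ser_mul big1 // => j _.
rewrite size_drop size_takel -1?ltnS //; case: eqP => [ji|_]; last by rewrite mul0r.
case: eqP => [dj|_]; last by rewrite mulr0.
case/eqP: sz_w; have := ltn_ord i; have := ltn_ord j.
by rewrite ji in dj *; move: dj; lia.
Qed.

Section FreeGroup.
Variables (k : fieldType) (G : affineGroup k) (S : finType).
Variable b : S -> pts G k^o.
Variable phi : forall R : comAlgType k, pts G R -> ncseries S R.
Hypothesis k0 : [pchar k] =i pred0.
Hypothesis phi_mul : forall (R : comAlgType k) (p q : pts G R),
  phi (p * q)%g =1 ser_mul (phi p) (phi q).
Hypothesis phi_bc : forall (R R' : comAlgType k) (u : {lrmorphism R -> R'})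
  (p : pts G R), phi (bc G u p) =1 u \o phi p.
Hypothesis phi_lie : forall (R : comAlgType k) (p : pts G R),
  exists2 x : series S R, lie_series x & phi p =1 ser_exp x.
Hypothesis phi_ex : forall (R : comAlgType k) (x : series S R), lie_series x ->
  exists! p : pts G R, phi p =1 ser_exp x.
Hypothesis phi_b : forall s, phi (b s) =1 ser_exp (@ser_letter k S k^o s).

Lemma phiM (R : comAlgType k) (p q : pts G R) : phi (p * q)%g = phi p * phi q.
Proof. by apply/funext/phi_mul. Qed.

Lemma phiBC (R R' : comAlgType k) (u : {lrmorphism R -> R'}) (p : pts G R) :
  phi (bc G u p) = fun w => u (phi p w).
Proof. by apply/funext/phi_bc. Qed.

Lemma phi_log (R : comAlgType k) (p : pts G R) : exists2 x : series S R,
  lie_series x & phi p = ser_exp x.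
Proof. by have [x x_lie /funext px] := phi_lie p; exists x. Qed.

Lemma phi_inj (R : comAlgType k) (p q : pts G R) : phi p = phi q -> p = q.
Proof.
have [x x_lie qx] := phi_lie q; have [r [_ r_uniq]] := phi_ex x_lie => pq.
by rewrite -(r_uniq p) ?pq // (r_uniq q).
Qed.

Lemma exp_pt (R : comAlgType k) (x : series S R) : lie_series x -> {p | phi p = ser_exp x}.
Proof.
move=> x_lie; apply: cid; have [p [px _]] := phi_ex x_lie.
by exists p; apply/funext.
Qed.

Lemma phi1 (R : comAlgType k) : phi (1%g : pts G R) = 1.
Proof.
have [p] := exp_pt (@lie_series0 k S R); rewrite ser_exp0 => p1.
suff -> : 1%g = p by [].
by apply: (mulgI p); rewrite mulg1; apply: phi_inj; rewrite phiM p1 mulr1.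
Qed.

Lemma phi_mulVg (R : comAlgType k) (p : pts G R) : phi (p^-1)%g * phi p = 1.
Proof. by rewrite -phiM mulVg phi1. Qed.

Lemma phi_ord_ge1 (R : comAlgType k) (p : pts G R) : ord_ge 1 (phi p - 1).
Proof.
have [x /lie_series_nil x0 ->] := phi_log p => [[|//]] _.
by rewrite ncsD ncsN ser_expE big_ord_recl big_ord0 fact0 invr1 scale1r addr0 subrr.
Qed.

Lemma phi_divl d (R : comAlgType k) (p q : pts G R) :
  ord_ge d (phi p - phi q) -> ord_ge d (phi (q^-1 * p)%g - 1).
Proof.
move=> dpq; rewrite phiM -(phi_mulVg q) -mulrBr.
exact: (@ord_geM k S R 0 d).
Qed.

Lemma phi_divl_log d (R : comAlgType k) (p q : pts G R) : ord_ge d (phi p - phi q) ->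
  exists x : ncseries S R,
    [/\ lie_series x, ord_ge d x & phi (q^-1 * p)%g = ser_exp x].
Proof.
move=> /phi_divl; have [x x_lie ->] := phi_log (q^-1 * p)%g => dx.
exists x; split => //; apply: ser_exp_ord_ge => //.
exact: lie_series_nil.
Qed.

Definition letter_pt (R : comAlgType k) (s : S) (a : R) : pts G R :=
  sval (exp_pt (@lie_letter_ser k S R s a)).

Lemma phi_letter (R : comAlgType k) s (a : R) : phi (letter_pt s a) = ser_exp (letter_ser s a).
Proof. exact: (svalP (exp_pt (lie_letter_ser s a))). Qed.

Lemma letter_ptD (R : comAlgType k) s (a c : R) :
  letter_pt s (a + c) = (letter_pt s a * letter_pt s c)%g.
Proof. by apply: phi_inj; rewrite phiM !phi_letter letter_expD. Qed.

Lemma letter_pt0 (R : comAlgType k) s : letter_pt s (0 : R) = 1%g.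
Proof.
by apply: (mulgI (letter_pt s (0 : R))); rewrite mulg1 -letter_ptD addr0.
Qed.

Lemma bc_letter (R R' : comAlgType k) (u : {lrmorphism R -> R'}) s a :
  bc G u (letter_pt s a) = letter_pt s (u a).
Proof.
apply: phi_inj; rewrite phiBC !phi_letter ser_exp_morph.
congr ser_exp; apply/funext=> w; rewrite rmorphM; congr (_ * _).
by rewrite /ser_letter; case: ifP; rewrite (rmorph1, rmorph0).
Qed.

Lemma letter_pt1 s : letter_pt s (1 : k^o) = b s.
Proof.
apply: phi_inj; rewrite phi_letter.
transitivity (ser_exp (@ser_letter k S k^o s)); last by apply/funext=> w; rewrite phi_b.
by congr ser_exp; apply/funext=> w; exact: mul1r.
Qed.

Inductive letter_gen (R : comAlgType k) : pts G R -> Prop :=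
| letter_gen1 : letter_gen 1%g
| letter_genM p s a : letter_gen p -> letter_gen (p * letter_pt s a)%g.

Lemma letter_gen_mul (R : comAlgType k) (p q : pts G R) :
  letter_gen p -> letter_gen q -> letter_gen (p * q)%g.
Proof.
move=> gp; elim=> [|r s a _ IHr]; first by rewrite mulg1.
by rewrite mulgA; exact: letter_genM.
Qed.

Lemma letter_gen_letter (R : comAlgType k) s (a : R) : letter_gen (letter_pt s a).
Proof. by rewrite -[letter_pt s a]mul1g; apply: letter_genM; constructor. Qed.

Lemma letter_gen_inv (R : comAlgType k) (p : pts G R) : letter_gen p -> letter_gen (p^-1)%g.
Proof.
elim=> [|r s a _ IHr]; first by rewrite invg1; constructor.
rewrite invgM; apply: letter_gen_mul => //.
suff -> : ((letter_pt s a)^-1)%g = letter_pt s (- a) by exact: letter_gen_letter.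
by apply: (mulgI (letter_pt s a)); rewrite mulgV -letter_ptD subrr letter_pt0.
Qed.

(** Leading terms of the subgroup generated by letters, as in the graded Lie ring of a filtered
    group: products of group elements add them, commutators bracket them. *)
Definition lead (R : comAlgType k) (d : nat) (z : ncseries S R) : Prop :=
  ord_ge d z /\ exists2 p, letter_gen p & ord_ge d.+1 (phi p - 1 - z).

Lemma lead0 (R : comAlgType k) d : lead d (0 : ncseries S R).
Proof.
split; first exact: ord_ge_zero.
exists 1%g; first by constructor.
by rewrite phi1 subrr subr0; exact: ord_ge_zero.
Qed.

Lemma lead_ord_ge (R : comAlgType k) d (z : ncseries S R) p :
  ord_ge d z -> ord_ge d.+1 (phi p - 1 - z) -> ord_ge d (phi p - 1).
Proof.
move=> dz /(ord_ge_le (leqnSn d)) dp.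
by rewrite -[_ - 1](subrK z); exact: ord_geD.
Qed.

Lemma leadD (R : comAlgType k) d (x y : ncseries S R) :
  (0 < d)%N -> lead d x -> lead d y -> lead d (x + y).
Proof.
move=> d_gt0 [dx [p gp px]] [dy [q gq qy]]; split; first exact: ord_geD.
exists (p * q)%g; first exact: letter_gen_mul.
have -> : phi (p * q)%g - 1 - (x + y) =
    (phi p - 1 - x) + (phi q - 1 - y) + (phi p - 1) * (phi q - 1).
  by rewrite phiM quasi_mul.
apply: ord_geD; first exact: ord_geD.
apply: (@ord_ge_le _ _ _ _ (d + d)); first by rewrite -addn1 leq_add2l.
by apply: ord_geM; [apply: lead_ord_ge px | apply: lead_ord_ge qy].
Qed.

Lemma lead_bracket (R : comAlgType k) d e (x y : ncseries S R) : (0 < d)%N -> (0 < e)%N ->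
  lead d x -> lead e y -> lead (d + e) (x * y - y * x).
Proof.
move=> d_gt0 e_gt0 [dx [p gp px]] [ey [q gq qy]].
have dp := lead_ord_ge dx px; have eq := lead_ord_ge ey qy.
split; first by apply: ord_geB; [|rewrite addnC]; exact: ord_geM.
exists (p * q * (q * p)^-1)%g.
  by apply: letter_gen_mul; [|apply: letter_gen_inv]; apply: letter_gen_mul.
set U := phi p - 1; set V := phi q - 1; rewrite -/U in px dp; rewrite -/V in qy eq.
set K := phi (q * p)^-1%g.
have -> : phi (p * q * (q * p)^-1)%g - 1 = (U * V - V * U) * K.
  have : phi (q * p)%g * K = 1 by rewrite -phiM mulgV phi1.
  move=> KV; transitivity (phi (p * q)%g * K - phi (q * p)%g * K).
    by rewrite KV [LHS]/= phiM.
  by rewrite -mulrBl !phiM quasi_comm.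
have Kd : ord_ge 1 (K - 1) by exact: phi_ord_ge1.
have UVd : ord_ge (d + e) (U * V - V * U).
  by apply: ord_geB; [|rewrite addnC]; exact: ord_geM.
have -> : (U * V - V * U) * K - (x * y - y * x) =
  (U * V - V * U) * (K - 1) + ((U - x) * V + x * (V - y) -
    ((V - y) * U + y * (U - x))).
  exact: comm_approx.
apply: ord_geD; first by rewrite -addn1; exact: ord_geM.
apply: ord_geB; apply: ord_geD.
- by rewrite -addSn; exact: ord_geM.
- by rewrite -addnS; exact: ord_geM.
- by rewrite addnC -addSn; exact: ord_geM.
- by rewrite addnC -addnS; exact: ord_geM.
Qed.

(** The scalar c is carried along because leading terms are not visibly closed under scaling; it is
    pushed down to a single letter, where [letter_pt s c] realizes it. In the bracket case the
    components of degree 0 vanish, so only positive degrees reach [lead_bracket]. *)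
Lemma lead_lie (R : comAlgType k) (x : series S R) : lie_poly x ->
  forall (c : R) d, (0 < d)%N -> lead d (c *: (ser_comp d x : ncseries S R)).
Proof.
elim=> {x} [s||x y _ IHx _ IHy|a x _ IHx|x y lx IHx ly IHy] c d d_gt0.
- have [->|d1] := eqVneq d 1%N.
    have -> : c *: (ser_comp 1 (@ser_letter k S R s) : ncseries S R) = letter_ser s c.
      apply/funext=> w; rewrite ncsZ /ser_comp /letter_ser /ser_letter.
      by case: (w =P [:: s]) => [->|] //; rewrite if_same.
    have sc : ord_ge 1 (letter_ser s c : ncseries S R).
      by case=> // _; rewrite /letter_ser mulr0.
    split=> //; exists (letter_pt s c); first exact: letter_gen_letter.
    by rewrite phi_letter; exact: ser_exp_lead.
  have -> : c *: (ser_comp d (@ser_letter k S R s) : ncseries S R) = 0.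
    apply/funext=> w; rewrite ncsZ /ser_comp /ser_letter.
    case: eqP => [sz_w|_]; last by rewrite mulr0.
    by case: eqP => [Dw|_]; [rewrite -sz_w Dw in d1 | rewrite mulr0].
  exact: lead0.
- have -> : c *: (ser_comp d (fun=> 0) : ncseries S R) = 0.
    by apply/funext=> w; rewrite ncsZ /ser_comp if_same mulr0.
  exact: lead0.
- have -> : c *: (ser_comp d (fun w => x w + y w) : ncseries S R) =
      c *: (ser_comp d x : ncseries S R) + c *: (ser_comp d y : ncseries S R).
    apply/funext=> w; rewrite ncsD !ncsZ /ser_comp -mulrDr.
    by case: eqP => // _; rewrite addr0.
  by apply: leadD => //; [apply: IHx | apply: IHy].
- have -> : c *: (ser_comp d (fun w => a * x w) : ncseries S R) =
      (c * a) *: (ser_comp d x : ncseries S R).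
    apply/funext=> w; rewrite !ncsZ /ser_comp -mulrA.
    by case: eqP => // _; rewrite !mulr0.
  exact: IHx.
have comp0 z : lie_poly z -> ser_comp 0 z = 0 :> ncseries S R.
  by move=> lz; apply/funext=> [[|//]]; rewrite /ser_comp /= lie_poly_nil.
have -> : c *: (ser_comp d (fun w => ser_mul x y w - ser_mul y x w) : ncseries S R) =
  \sum_(i < d.+1) (c *: (ser_comp i x : ncseries S R) * ser_comp (d - i) y -
                   (ser_comp (d - i) y : ncseries S R) * (c *: (ser_comp i x : ncseries S R))).
  rewrite (eq_bigr (fun i : 'I_d.+1 => c *: ((ser_comp i x : ncseries S R) * ser_comp (d - i) y -
                   (ser_comp (d - i) y : ncseries S R) * ser_comp i x))); last first.
    by move=> i _; rewrite scalerBr -scalerAl -scalerAr.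
  rewrite -scaler_sumr; congr (_ *: _); rewrite sumrB.
  rewrite [X in _ - X](reindex_inj rev_ord_inj) /=.
  have -> : \sum_(i < d.+1) (ser_comp (d - (d.+1 - i.+1)) y : ncseries S R) *
      ser_comp (d.+1 - i.+1) x =
    \sum_(i < d.+1) (ser_comp i y : ncseries S R) * ser_comp (d - i) x.
    by apply: eq_bigr => i _; rewrite subSS subKn // -ltnS.
  rewrite -!ser_compM; apply/funext=> w; rewrite ncsD ncsN /ser_comp.
  by case: eqP => // _; rewrite subrr.
elim/big_ind: _ => [||i _]; [exact: lead0 | exact: (fun u v => @leadD R d u v d_gt0) |].
have [i0|i_gt0] := posnP i.
  by rewrite i0 comp0 // scaler0 mul0r mulr0 subrr; exact: lead0.
have [di0|di_gt0] := posnP (d - i).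
  by rewrite di0 comp0 // mul0r mulr0 subrr; exact: lead0.
have Dd : (i + (d - i))%N = d by rewrite subnKC // -ltnS.
rewrite -[X in lead X]Dd; apply: lead_bracket => //; first exact: IHx.
by rewrite -[ser_comp _ y](scale1r (_ : ncseries S R)); exact: IHy.
Qed.

(** Successive approximation: if q agrees with p up to degree d, the logarithm of q^-1 p starts with
    a Lie polynomial of degree d.+1, which is the leading term of some generated r, and q r is right
    in one more degree. *)
Lemma letter_gen_dense (R : comAlgType k) (p : pts G R) d :
  exists2 q, letter_gen q & ord_ge d.+1 (phi p - phi q).
Proof.
elim: d => [|d [q gq pq]].
  exists 1%g; first by constructor.
  by rewrite phi1; exact: phi_ord_ge1.
have [x [x_lie dx qpx]] := phi_divl_log pq.
have [_ [r gr rx]] := lead_lie (x_lie d.+1) 1 (ltn0Sn d).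
exists (q * r)%g; first exact: letter_gen_mul.
have -> : phi p - phi (q * r)%g = phi q * (phi (q^-1 * p)%g - phi r).
  by rewrite mulrBr -!phiM mulKVg.
apply: (@ord_geM k S R 0 d.+2) => //.
have -> : phi (q^-1 * p)%g - phi r = ((ser_exp x : ncseries S R) - 1 - x) - (phi r - 1 - x).
  by rewrite qpx opprB addrA subrK opprB addrA subrK.
apply: ord_geB; first exact: ser_exp_lead.
rewrite scale1r in rx.
rewrite -[_ - x](subrKA (ser_comp d.+1 (ser_comp d.+1 x : series S R) : ncseries S R)).
apply: ord_geD => // w; rewrite ltnS leq_eqVlt ncsD ncsN /ser_comp.
case/predU1P=> [->|lt_wd]; first by rewrite eqxx subrr.
by rewrite ltn_eqF // dx // subr0.
Qed.

(** * Dilations and the dependence of regular functions on words of bounded length *)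

Section Dilation.
Variables (R R' : comAlgType k) (u : {lrmorphism R -> R'}) (t : R').

Lemma dilate_pt (p : pts G R) : {q : pts G R' | phi q = dilate u t (phi p)}.
Proof.
apply: cid; have [x x_lie ->] := phi_log p.
have [q Dq] := exp_pt (lie_series_weigh u (fun n => t ^+ n) x_lie).
by exists q; rewrite Dq dilate_exp.
Qed.

Definition dil p := sval (dilate_pt p).
Lemma phi_dil p : phi (dil p) = dilate u t (phi p).
Proof. exact: (svalP (dilate_pt p)). Qed.

End Dilation.

(* A regular function has bounded degree with respect to dilations, because it
   does so at the universal point. *)
Lemma dil_degree (f : coordAlg G) : exists d, forall R (p : pts G R),
  (size (ev G (dil (polyAlg_const R) 'X p) f : {poly R}) <= d)%N.
Proof.
exists (size (ev G (dil (polyAlg_const _) 'X (univ G)) f : {poly _})) => R p.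
have -> : dil (polyAlg_const R) 'X p =
    bc G (polyAlg_map (ev G p)) (dil (polyAlg_const _) 'X (univ G)).
  apply: phi_inj; rewrite phiBC !phi_dil -{1}(bc_univ p) phiBC.
  apply/funext=> w; rewrite /dilate /ser_weigh polyAlg_mapE.
  by rewrite rmorphM rmorphXn /= map_polyX !polyAlg_constE map_polyC.
rewrite ev_bcE polyAlg_mapE; exact: size_poly.
Qed.

(* If p and q agree up to length d, then in F(R[t]) the dilated points differ
   by the exponential of a Lie series divisible by t^d; replacing the factor t^d
   by an independent variable s and letting s be t^d or 0 compares their values. *)
Lemma finite_determination (f : coordAlg G) : exists d, forall R (p q : pts G R),
  ord_ge d (phi p - phi q) -> ev G p f = ev G q f.
Proof.
have [d sz_d] := dil_degree f; exists d => R p q dpq.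
have [x [x_lie dx Dx]] := phi_divl_log dpq.
pose Rt := polyAlg R; pose Rts := polyAlg Rt.
pose c := polyAlg_const R; pose c' := polyAlg_const Rt.
pose dp := dil c 'X p; pose dq := dil c 'X q.
(* Here 'X is the independent variable s. The exponent n - d is truncated at 0 for n < d, which is
   harmless because x has no words of length below d. *)
have [y Dy] := exp_pt (lie_series_weigh (comp_lr c' c)
  (fun n => 'X * c' ('X^(n - d) : {poly R}) : Rts) x_lie).
pose F : {poly {poly R}} := ev G (bc G c' dq * y)%g f.
have evalF (a : Rt) : ev G (bc G (polyAlg_eval idfun a) (bc G c' dq * y)%g) f = F.[a].
  by rewrite ev_bcE polyAlg_evalE map_poly_id.
have F0 : ev G dq f = F.[0].
  rewrite -evalF gmulfM; congr (ev G _ f); apply: phi_inj.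
  rewrite phiM !phiBC Dy.
  have -> : (fun w => polyAlg_eval idfun 0 (c' (phi dq w))) = phi dq.
    by apply/funext=> w; rewrite polyAlg_evalE /c' polyAlg_constE map_polyC hornerC.
  rewrite (ser_exp_morph (polyAlg_eval idfun (0 : Rt))).
  rewrite (_ : (fun w => _) = (fun=> 0)) ?ser_exp0 ?mulr1 //.
  apply/funext=> w; rewrite !rmorphM /= polyAlg_evalE map_polyX hornerX.
  by rewrite !mul0r.
have Fd : ev G dp f = F.['X^d].
  rewrite -evalF gmulfM; congr (ev G _ f); apply: phi_inj.
  rewrite phiM !phiBC Dy.
  have -> : (fun w => polyAlg_eval idfun ('X^d : Rt) (c' (phi dq w))) = phi dq.
    by apply/funext=> w; rewrite polyAlg_evalE /c' polyAlg_constE map_polyC hornerC.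
  rewrite (ser_exp_morph (polyAlg_eval idfun ('X^d : Rt))).
  have -> : phi dp = phi dq * dilate c 'X (phi (q^-1 * p)%g).
    by rewrite !phi_dil -dilateM -phiM mulKVg.
  congr (_ * _); rewrite Dx dilate_exp; congr ser_exp; apply/funext=> w.
  rewrite /dilate /ser_weigh.
  have [lt_wd|le_dw] := ltnP (size w) d; first by rewrite dx // !rmorph0 !mulr0 rmorph0.
  rewrite !rmorphM /= !polyAlg_evalE map_polyX hornerX /c' !polyAlg_constE !map_polyC !hornerC /=.
  by rewrite -exprD subnKC.
(* F(t^d) - F(0) is a multiple of t^d, while both values have degree less than d in t. Afterwards t
   is set to 1. *)
have : ev G dp f = ev G dq f.
  apply/polyP=> i; have [lt_id|le_di] := ltnP i d; last first.
    by rewrite !nth_default // (leq_trans (sz_d _ _)).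
  have /factor_theorem[h Dh] : root (F - F.[0]%:P) 0.
    by rewrite /root !hornerE subrr.
  rewrite Fd F0; apply/eqP; rewrite -subr_eq0 -coefB.
  have -> : F.['X^d] - F.[0] = h.['X^d] * 'X^d.
    have := congr1 (fun r : {poly {poly R}} => r.['X^d]) Dh.
    by rewrite hornerD hornerN hornerC hornerM hornerXsubC subr0.
  by rewrite coefMXn lt_id.
move=> /(congr1 (polyAlg_eval idfun (1 : R))).
have eval1 r : bc G (polyAlg_eval idfun 1) (dil c 'X r) = r.
  apply: phi_inj; rewrite phiBC phi_dil; apply/funext=> w.
  rewrite /dilate /ser_weigh rmorphM rmorphXn /= !polyAlg_evalE map_polyX hornerX.
  by rewrite expr1n mul1r polyAlg_constE map_polyC hornerC.
by rewrite -!ev_bcE !eval1.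
Qed.

Definition gen_prod (l : seq S) : pts G k^o := foldr (fun s q => b s * q)%g 1%g l.

Lemma gen_prod_cat l l' : gen_prod (l ++ l') = (gen_prod l * gen_prod l')%g.
Proof. by elim: l => [|s l IHl] /=; rewrite ?mul1g // IHl mulgA. Qed.

Lemma letter_pt_nat (R : comAlgType k) s n :
  letter_pt s (n%:R : R) = bc G (scalar_lr R) (gen_prod (nseq n s)).
Proof.
elim: n => [|n IHn]; first by rewrite letter_pt0 multiplicative1.
rewrite -add1n natrD letter_ptD IHn /= gmulfM; congr (_ * _)%g.
by rewrite -letter_pt1 bc_letter scalar_lrE scale1r.
Qed.

Lemma gen_dense (f : coordAlg G) : (forall l, ev G (gen_prod l) f = 0) -> f = 0.
Proof.
move=> f0; rewrite -[f]ev_univ.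
have [d f_det] := finite_determination f.
have [q gq pq] := letter_gen_dense (univ G) d.
rewrite (f_det _ _ q); last exact: ord_ge_le pq.
(* Letters are traded for products of generators from right to left, and l collects what has been
   converted. The coefficient of the last letter becomes a variable; at a natural number n that
   letter is a product of n generators and is absorbed in l. *)
suff Iq l : ev G (q * bc G (scalar_lr _) (gen_prod l))%g f = 0.
  by have := Iq [::]; rewrite /= multiplicative1 mulg1.
elim: gq l => [|p s a _ IHp] l.
  by rewrite mul1g ev_bcE f0 rmorph0.
pose c := polyAlg_const (coordAlg G).
pose F : {poly coordAlg G} := ev G (bc G c p * letter_pt s ('X : polyAlg _) *
  bc G (scalar_lr _) (gen_prod l))%g f.
have evalF a' : F.[a'] = ev G (p * letter_pt s a' * bc G (scalar_lr _) (gen_prod l))%g f.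
  rewrite -[F](@map_poly_id _ idfun) // -[LHS](polyAlg_evalE idfun) -ev_bcE.
  rewrite !gmulfM !bc_bc bc_letter; congr (ev G (_ * _ * _) f)%g.
  - by apply: bc_id => z; rewrite /= polyAlg_evalE polyAlg_constE map_polyC hornerC.
  - by rewrite polyAlg_evalE map_polyX hornerX.
  - by apply: bc_eq => z; rewrite /= !scalar_lrE alg_morphC.
rewrite -evalF (@poly_vanish_nat k _ F 0) ?horner0 // => n _.
by rewrite evalF letter_pt_nat -mulgA -gmulfM -gen_prod_cat IHp.
Qed.

End FreeGroup.

(** * Evaluation of series at nilpotent matrices *)

Lemma triangle_sum (V : nmodType) (F : nat -> nat -> V) K :
  \sum_(m < K) \sum_(i < m.+1) F i (m - i)%N =
  \sum_(i < K) \sum_(j < K - i) F i j.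
Proof.
elim: K F => [|K IHK] F; first by rewrite !big_ord0.
rewrite [RHS]big_ord_recl subn0.
rewrite (eq_bigr (fun m : 'I_K.+1 => F 0 m + \sum_(i < m) F i.+1 (m - i.+1)%N)).
  rewrite big_split /=; congr (_ + _).
  rewrite big_ord_recl big_ord0 add0r -(IHK (fun i j => F i.+1 j)).
  by apply: eq_bigr => m _; apply: eq_bigr => i _; rewrite subSS.
by move=> m _; rewrite big_ord_recl subn0.
Qed.

Section StrictlyUpper.
Variable n : nat.

Definition upper (R : pzRingType) (a : nat) (A : 'M[R]_n) :=
  forall i j : 'I_n, (j < i + a)%N -> A i j = 0.

Section Ring.
Variable R : comNzRingType.
Implicit Types A B : 'M[R]_n.

Lemma upper_zero a : upper a (0 : 'M[R]_n).
Proof. by move=> i j _; rewrite mxE. Qed.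

Lemma upperD a A B : upper a A -> upper a B -> upper a (A + B).
Proof. by move=> aA aB i j ij; rewrite mxE aA ?aB ?addr0. Qed.

Lemma upperN a A : upper a A -> upper a (- A).
Proof. by move=> aA i j ij; rewrite mxE aA ?oppr0. Qed.

Lemma upperZ a c A : upper a A -> upper a (c *: A).
Proof. by move=> aA i j ij; rewrite mxE aA ?mulr0. Qed.

Lemma upper_sum a I (r : seq I) (P : pred I) (F : I -> 'M[R]_n) :
  (forall i, P i -> upper a (F i)) -> upper a (\sum_(i <- r | P i) F i).
Proof.
by move=> aF; elim/big_ind: _ => //; [exact: upper_zero | exact: upperD].
Qed.

Lemma upper_le a b A : (a <= b)%N -> upper b A -> upper a A.
Proof. by move=> le_ab bA i j ij; apply: bA; apply: leq_trans ij _; rewrite leq_add2l. Qed.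

Lemma upperM a b A B : upper a A -> upper b B -> upper (a + b) (A *m B).
Proof.
move=> aA bB i j ij; rewrite mxE big1 // => l _.
have [lt_l|le_l] := ltnP l (i + a); first by rewrite aA ?mul0r.
by rewrite bB ?mulr0 //; lia.
Qed.

Lemma upper_scalar c : upper 0 (c%:M : 'M[R]_n).
Proof. by move=> i j ij; rewrite mxE; case: eqP => // E; move: ij; rewrite E; lia. Qed.

Lemma upperX a A m : upper a A -> upper (m * a) (A ^+ m).
Proof.
move=> aA; elim: m => [|m IHm]; first by rewrite mul0n; exact: upper_scalar.
by rewrite exprS mulSn; exact: upperM.
Qed.

Lemma upper_eq0 a A : (n <= a)%N -> upper a A -> A = 0.
Proof.
move=> le_na aA; apply/matrixP=> i j; rewrite mxE aA //.
by have := ltn_ord j; lia.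
Qed.

End Ring.

(** For N = A - 1 idempotence reads N = - N^2, which pushes N up through all superdiagonals. *)
Lemma upper_idem (R : comNzRingType) (A : 'M[R]_n) :
  upper 1 (A - 1) -> A *m A = A -> A = 1.
Proof.
move=> A1 AA; apply/eqP; rewrite -subr_eq0; apply/eqP.
suff /(_ n) : forall d, upper d.+1 (A - 1) by exact: upper_eq0.
elim=> // d IHd.
have -> : A - 1 = - ((A - 1) *m (A - 1)).
  by rewrite mulmxBr mulmxBl AA mul1mx subrr sub0r opprK mulmx1.
by apply: upperN; rewrite -[d.+2]addn1; exact: upperM.
Qed.

(* A logarithm of 1 + X, by successive approximation: if exp N = 1 + X modulo
   the d-th superdiagonal, then N - (exp N - 1 - X) is right modulo the next one. *)
Lemma upper_log (k : fieldType) (X : 'M[k]_n) : upper 1 X ->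
  exists2 N, upper 1 N & \sum_(m < n.+2) (m`!%:R)^-1 *: N ^+ m = 1 + X.
Proof.
(* Powers from the n-th on vanish; the bound n.+2 allows the terms of degree 0 and 1 to be split off
   for every n, including 0 and 1. *)
move=> X1; pose E (N : 'M[k]_n) := \sum_(m < n.+2) (m`!%:R)^-1 *: N ^+ m.
have pow_diff d (N C : 'M[k]_n) m : upper 1 N -> upper d.+1 C ->
    upper (d + m) ((N - C) ^+ m - N ^+ m).
  move=> N1 Cd; have NC1 : upper 1 (N - C).
    by apply: upperD => //; apply/upperN/(upper_le _ Cd).
  elim: m => [|m IHm]; first by rewrite subrr; exact: upper_zero.
  have -> : (N - C) ^+ m.+1 - N ^+ m.+1 =
      - C * (N - C) ^+ m + N * ((N - C) ^+ m - N ^+ m).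
    by rewrite !exprS mulrBr addrA -mulrDl [- C + N]addrC.
  apply: upperD; last by rewrite addnS -add1n; exact: upperM.
  by rewrite addnS -addSn; apply: upperM; [exact: upperN | rewrite -{1}[m]muln1; exact: upperX].
suff /(_ n) [N N1 /(upper_eq0 (leqnSn n)) EN] :
    forall d, exists2 N, upper 1 N & upper d.+1 (E N - 1 - X).
  by exists N => //; apply/eqP; rewrite -subr_eq0 opprD addrA; apply/eqP.
elim=> [|d [N N1 Nd]].
  exists 0; first exact: upper_zero.
  rewrite /E big_ord_recl big1 ?addr0 => [|m _].
    by rewrite fact0 invr1 scale1r expr0 subrr sub0r; exact: upperN.
  by rewrite exprS mul0r scaler0.
set C := E N - 1 - X in Nd; exists (N - C).
  by apply: upperD => //; apply/upperN/(upper_le _ Nd).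
have -> : E (N - C) - 1 - X = (E (N - C) - E N) + C.
  by rewrite /C !addrA subrK.
rewrite /E -sumrB !big_ord_recl /= !expr0 !expr1 subrr add0r.
rewrite -[bump 0 0]/1%N -[1`!]/1%N invr1 !scale1r [N - C - N]addrAC subrr add0r.
rewrite addrAC addNr add0r; apply: upper_sum => m _.
rewrite -scalerBr; apply/upperZ/(@upper_le _ _ (d + m.+2)) => //.
  by rewrite -addn2 leq_add2l.
exact: pow_diff.
Qed.

End StrictlyUpper.

Section WordEvaluation.
Variables (k : fieldType) (S : finType) (n : nat) (N : S -> 'M[k]_n).
Hypothesis N1 : forall s, upper 1 (N s).

Section Algebra.
Variable R : comAlgType k.
Implicit Types x y : ncseries S R.

Definition mx_alg (A : 'M[k]_n) : 'M[R]_n := map_mx (fun c => c%:A) A.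

Lemma mx_algM A B : mx_alg (A *m B) = mx_alg A *m mx_alg B.
Proof.
apply/matrixP=> i j; rewrite !mxE scaler_suml; apply: eq_bigr => l _.
by rewrite !mxE -scalerAl mul1r scalerA.
Qed.

Definition shift (s : S) x : ncseries S R := fun w => x (s :: w).

(* The sum of x_w N_w over the words w of length m. *)
Fixpoint word_eval (m : nat) (x : ncseries S R) : 'M[R]_n :=
  if m is m'.+1
  then \sum_s mx_alg (N s) *m word_eval m' (shift s x)
  else (x [::])%:M.

Lemma word_evalD m x y : word_eval m (x + y) = word_eval m x + word_eval m y.
Proof.
elim: m x y => [|m IHm] x y /=; first by rewrite -raddfD.
by rewrite -big_split /=; apply: eq_bigr => s _; rewrite -mulmxDr -IHm.
Qed.

Lemma word_evalZ m c x : word_eval m (c *: x) = c *: word_eval m x.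
Proof.
elim: m x => [|m IHm] x /=; first by rewrite scale_scalar_mx.
by rewrite scaler_sumr; apply: eq_bigr => s _; rewrite scalemxAr -IHm.
Qed.

Lemma word_eval_upper m x : upper m (word_eval m x).
Proof.
elim: m x => [|m IHm] x /=; first exact: upper_scalar.
apply: upper_sum => s _; rewrite -add1n; apply: upperM => // i j ij.
by rewrite mxE N1 ?scale0r.
Qed.

Lemma word_evalM m x y :
  word_eval m (x * y) = \sum_(i < m.+1) word_eval i x *m word_eval (m - i) y.
Proof.
elim: m x => [|m IHm] x.
  by rewrite big_ord_recl big_ord0 addr0 /= ncsM ser_mul_nil scalar_mxM.
have shiftM s : shift s (x * y) = x [::] *: shift s y + shift s x * y.
  by apply/funext=> w; rewrite /shift ncsM ser_mul_cons.
rewrite big_ord_recl subn0 mul_scalar_mx /= scaler_sumr.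
under [X in _ = _ + X]eq_bigr => i _ do rewrite mulmx_suml.
rewrite [X in _ = _ + X]exchange_big -big_split; apply: eq_bigr => s _ /=.
rewrite shiftM word_evalD word_evalZ IHm mulmxDr -scalemxAr; congr (_ + _).
rewrite mulmx_sumr; apply: eq_bigr => i _.
by rewrite mulmxA.
Qed.

Definition ser_eval x := \sum_(m < n.+2) word_eval m x.

(** The two truncations differ by terms of total degree at least n.+2, and a product of that many
    strictly upper triangular n x n matrices is zero. *)
Lemma ser_evalM x y : ser_eval (x * y) = ser_eval x *m ser_eval y.
Proof.
rewrite /ser_eval; under eq_bigr => m _ do rewrite word_evalM.
rewrite (triangle_sum (fun i j => word_eval i x *m word_eval j y)).
rewrite mulmx_suml; apply: eq_bigr => i _; rewrite mulmx_sumr.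
rewrite -(big_mkord xpredT (fun j => word_eval i x *m word_eval j y)).
rewrite -(big_mkord xpredT (fun j => word_eval i x *m word_eval j y)).
rewrite [RHS](@big_cat_nat _ _ _ (n.+2 - i)%N) ?leq_subr //=.
rewrite [X in _ = _ + X]big_nat_cond [X in _ = _ + X]big1 ?addr0 //.
move=> j /andP[/andP[le_j _] _].
apply: (@upper_eq0 _ _ (i + j)); last by apply: upperM; exact: word_eval_upper.
by have := ltn_ord i; lia.
Qed.

Lemma ser_eval1 : ser_eval 1 = 1.
Proof.
rewrite /ser_eval big_ord_recl big1 ?addr0 // => m _ /=.
rewrite big1 // => s _; rewrite (_ : shift s 1 = 0 *: 0) ?scale0r //.
by rewrite -(scale0r (0 : ncseries S R)) word_evalZ scale0r mulmx0.
Qed.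

Lemma word_eval_pow s (f : nat -> R) m x :
  (forall w, x w = if w == nseq (size w) s then f (size w) else 0) ->
  word_eval m x = f m *: mx_alg (N s ^+ m).
Proof.
elim: m f x => [|m IHm] f x Dx /=.
  rewrite Dx /= -scalemx1; congr (_ *: _); apply/matrixP=> i j.
  by rewrite !mxE; case: eqP => _; rewrite ?scale1r ?scale0r.
rewrite (bigD1 s) //= big1 ?addr0 => [|t ne_ts].
  rewrite (IHm (fun i => f i.+1)) => [|w]; last by rewrite /shift Dx /= eqseq_cons eqxx.
  by rewrite -scalemxAr exprS mx_algM.
rewrite (_ : shift t x = 0 *: 0).
  by rewrite word_evalZ scale0r mulmx0.
by apply/funext=> w; rewrite /shift Dx /= eqseq_cons (negPf ne_ts) scale0r.
Qed.

End Algebra.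

Lemma map_word_eval (R R' : comAlgType k) (u : {lrmorphism R -> R'}) m x :
  map_mx u (word_eval m x) = word_eval m (fun w => u (x w)).
Proof.
elim: m x => [|m IHm] x /=; first by rewrite map_scalar_mx.
rewrite map_mx_sum; apply: eq_bigr => s _; rewrite map_mxM IHm.
by congr (_ *m _); apply/matrixP=> i j; rewrite !mxE; exact: alg_morphC.
Qed.

Lemma map_ser_eval (R R' : comAlgType k) (u : {lrmorphism R -> R'}) x :
  map_mx u (ser_eval x) = ser_eval (fun w => u (x w)).
Proof.
by rewrite map_mx_sum; apply: eq_bigr => m _; rewrite map_word_eval.
Qed.

Lemma ser_eval_letter s : ser_eval (ser_exp (@ser_letter k S k^o s)) =
  \sum_(m < n.+2) (m`!%:R)^-1 *: N s ^+ m.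
Proof.
apply: eq_bigr => m _.
rewrite (@word_eval_pow _ s (fun m => (m`!%:R : k)^-1 : k^o)) => [|w].
  by congr (_ *: _); apply/matrixP=> i j; rewrite mxE /GRing.scale /= mulr1.
have -> : @ser_letter k S k^o s = letter_ser s (1 : k^o).
  by apply/funext=> v; rewrite /letter_ser mul1r.
by rewrite letter_exp expr1n /GRing.scale /= mulr1.
Qed.

End WordEvaluation.

(** * Universal property of free prounipotent groups *)

Section FreeBasis.
Variables (k : fieldType) (G : affineGroup k) (S : finType).
Variable b : S -> pts G k^o.
Hypotheses (k0 : [pchar k] =i pred0) (b_free : free_basis b).

Lemma free_gen_dense (f : coordAlg G) :
  (forall l, ev G (gen_prod b l) f = 0) -> f = 0.
Proof.
by have [phi [phiM phi_bc phi_lie phi_ex phi_b]] := b_free; exact: gen_dense.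
Qed.

Lemma free_gen_eq (f g : coordAlg G) :
  (forall l, ev G (gen_prod b l) f = ev G (gen_prod b l) g) -> f = g.
Proof.
move=> fg; apply/eqP; rewrite -subr_eq0; apply/eqP/free_gen_dense => l.
by rewrite rmorphB /= fg subrr.
Qed.

(** The logarithms of the matrices 1 + X s are substituted for the letters in the series of the
    universal point. This is a representation over all R at once, with no control yet over the
    subgroup in which it lands. *)
Lemma free_matrix n (X : S -> 'M[k]_n) : (forall s, upper 1 (X s)) ->
  exists A : 'M[coordAlg G]_n,
    (forall (R : comAlgType k) (p q : pts G R),
       map_mx (ev G (p * q)%g) A = map_mx (ev G p) A *m map_mx (ev G q) A) /\
    map_mx (ev G (1%g : pts G k^o)) A = 1 /\
    forall s, map_mx (ev G (b s)) A = 1 + X s.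
Proof.
have [phi [phiM phi_bc phi_lie phi_ex phi_b]] := b_free.
move=> X1; have /choice[N N_P] s : exists N, upper 1 N /\
    \sum_(m < n.+2) (m`!%:R)^-1 *: N ^+ m = 1 + X s.
  by have [N] := upper_log (X1 s); exists N.
exists (ser_eval N (phi _ (univ G))).
have evA (R : comAlgType k) (p : pts G R) :
    map_mx (ev G p) (ser_eval N (phi _ (univ G))) = ser_eval N (phi _ p).
  rewrite map_ser_eval; congr ser_eval; apply/funext=> w.
  by rewrite -[in RHS](bc_univ p) phi_bc.
split=> [R p q|].
  rewrite !evA -ser_evalM => [|s]; last by have [] := N_P s.
  congr ser_eval; apply/funext=> w.
  by rewrite phiM.
split=> [|s].
  rewrite evA -[RHS](ser_eval1 N); congr ser_eval.
  exact: (phi1 phiM phi_lie phi_ex).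
have [_ <-] := N_P s; rewrite evA -(ser_eval_letter N); congr ser_eval.
by apply/funext=> w; rewrite phi_b.
Qed.

End FreeBasis.

Lemma unipotent_pt_eq (k : fieldType) (U : affineGroup k) n
    (M : 'M[coordAlg U]_n) :
  (forall B : coordAlg U -> Prop,
      (forall c : k, B c%:A) ->
      (forall f g, B f -> B g -> B (f + g)) ->
      (forall f g, B f -> B g -> B (f * g)) ->
      (forall i j, B (M i j)) ->
      forall f, B f) ->
  forall (R : comAlgType k) (p q : pts U R),
    map_mx (ev U p) M = map_mx (ev U q) M -> p = q.
Proof.
move=> M_gen R p q pq; apply: ev_inj; apply: M_gen => [c|f g|f g|i j].
- by rewrite !alg_morphC.
- by rewrite !rmorphD /= => -> ->.
- by rewrite !rmorphM /= => -> ->.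
- by have /matrixP/(_ i j) := pq; rewrite !mxE.
Qed.

Section UniversalProperty.
Variables (k : fieldType) (G : affineGroup k) (S : finType).
Variable b : S -> pts G k^o.
Hypotheses (k0 : [pchar k] =i pred0) (b_free : free_basis b).

Lemma map_gen_prod (U V : affineGroup k) (f : grpHom U V) (u : S -> pts U k^o) l :
  f k^o (gen_prod u l) = gen_prod (fun s => f k^o (u s)) l.
Proof.
elim: l => [|s l IHl] /=; first exact: multiplicative1.
by rewrite gmulfM IHl.
Qed.

Lemma free_hom_eq (U : affineGroup k) (f g : grpHom G U) :
  (forall s, f k^o (b s) = g k^o (b s)) -> forall R p, f R p = g R p.
Proof.
move=> fg R p; apply: ev_inj => a; rewrite !ev_hom; congr (ev G p _).
apply: (free_gen_eq k0 b_free) => l; rewrite -!ev_hom !map_gen_prod.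
congr (ev U _ a); elim: l => //= s l ->.
by rewrite fg.
Qed.

(* A regular function on U restricts to the monoid generated by the u s; by
   density there is at most one regular function on G with the same values, and
   those for which there is one form a subalgebra containing the generators. *)
Lemma free_pt_unipotent (U : affineGroup k) (u : S -> pts U k^o) : unipotent U ->
  exists2 g : pts U (coordAlg G),
    forall l, bc U (ev G (gen_prod b l)) g = gen_prod u l &
    forall (R : comAlgType k) (p q : pts G R),
      bc U (ev G (p * q)%g) g = (bc U (ev G p) g * bc U (ev G q) g)%g.
Proof.
move=> [n [M [M_low M_diag MM M_gen]]].
have Mu (p : pts U k^o) : upper 1 (map_mx (ev U p) M - 1).
  move=> i j; rewrite addn1 ltnS leq_eqVlt => /predU1P[/val_inj->|lt_ji].
    by rewrite !mxE M_diag rmorph1 eqxx subrr.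
  by rewrite !mxE M_low // rmorph0 -val_eqE gtn_eqF // subrr.
have M1 : map_mx (ev U (1%g : pts U k^o)) M = 1.
  by apply: upper_idem; rewrite // -MM mulg1.
have [A [AM [A1 Ab]]] := free_matrix b_free (fun s => Mu (u s)).
have {Ab} Al l : map_mx (ev G (gen_prod b l)) A = map_mx (ev U (gen_prod u l)) M.
  elim: l => [|s l IHl] /=; first by rewrite A1 M1.
  by rewrite AM MM IHl Ab addrC subrK.
pose extends f a := forall l, ev G (gen_prod b l) a = ev U (gen_prod u l) f.
have /choice[F FP] f : exists a, extends f a.
  apply: (M_gen (fun f => exists a, extends f a)) f => [c|f g [x fx] [y gy]|f g [x fx] [y gy]|i j].
  - by exists c%:A => l; rewrite !alg_morphC.
  - by exists (x + y) => l; rewrite !rmorphD /= fx gy.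
  - by exists (x * y) => l; rewrite !rmorphM /= fx gy.
  - by exists (A i j) => l; have /matrixP/(_ i j) := Al l; rewrite !mxE.
have F_uniq f a : extends f a -> F f = a.
  by move=> fa; apply: (free_gen_eq k0 b_free) => l; rewrite FP fa.
have [F' F'P] : {F' : {lrmorphism coordAlg U -> coordAlg G} | F' =1 F}.
  apply: alg_morph => [f g|f g|c]; apply: F_uniq => l.
  - by rewrite !rmorphD /= !FP.
  - by rewrite !rmorphM /= !FP.
  - by rewrite !alg_morphC.
have [g gF] := pt_of F'.
have gA (R : comAlgType k) (p : pts G R) :
    map_mx (ev U (bc U (ev G p) g)) M = map_mx (ev G p) A.
  apply/matrixP=> i j; rewrite !mxE ev_bcE gF F'P; congr (ev G p _).
  by apply: F_uniq => l; have /matrixP/(_ i j) := Al l; rewrite !mxE.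
exists g.
- move=> l; apply: (unipotent_pt_eq M_gen).
  by rewrite gA Al.
- by move=> R p q; apply: (unipotent_pt_eq M_gen); rewrite MM !gA AM.
Qed.

(** Each unipotent quotient of U receives a point over the coordinate algebra of G. These points are
    compatible with the transition maps because they are so on the dense monoid of generators, and
    the limit property over that algebra assembles them into one point of U. *)
Lemma free_hom_ex (U : affineGroup k) (u : S -> pts U k^o) : prounipotent U ->
  exists f : grpHom G U, forall s, f k^o (b s) = u s.
Proof.
move=> [I [le [V [tr [pr [_ [_ _ _] V_unip [_ _ tr_pr] U_lim]]]]]].
have pr_inj (R : comAlgType k) (x y : pts U R) :
    (forall i, pr i R x = pr i R y) -> x = y.
  move=> xy; have [i j e|z [_ z_uniq]] := U_lim R (fun i => pr i R y).
    exact: tr_pr.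
  by rewrite -(z_uniq x xy) -(z_uniq y).
have [g g_gen gM] :=
  all_sig2 (fun i => cid2 (free_pt_unipotent (fun s => pr i k^o (u s)) (V_unip i))).
have tr_g i j (e : le i j) : tr i j e _ (g j) = g i.
  apply: ev_inj => f; rewrite ev_hom; apply: (free_gen_eq k0 b_free) => l.
  rewrite -!ev_bcE -ev_hom !g_gen map_gen_prod; congr (ev _ _ f).
  by congr (gen_prod _ l); apply/funext=> s; rewrite tr_pr.
have [h [gh _]] := U_lim _ g tr_g.
have hM (R : comAlgType k) (p q : pts G R) :
  bc U (ev G (p * q)%g) h = (bc U (ev G p) h * bc U (ev G q) h)%g.
  by apply: pr_inj => i; rewrite gmulfM !hom_nat gh gM.
exists (hom_of_pt hM) => s; apply: pr_inj => i /=.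
by rewrite hom_nat gh; have := g_gen i [:: s]; rewrite /= !mulg1.
Qed.

End UniversalProperty.

(** * Extension of characters *)

Lemma coef_XaddCX (A : comNzRingType) (c : A) n i :
  (('X + c%:P) ^+ n)`_i = c ^+ (n - i) *+ 'C(n, i).
Proof.
elim: n i => [|n IHn] [|i].
- by rewrite coef1.
- by rewrite coef1 bin0n.
- by rewrite exprS mulrDl coefD coefXM coefCM add0r IHn !bin0 !subn0 exprS.
rewrite exprS mulrDl coefD coefXM coefCM !IHn /= binS mulrnDr subSS addrC.
congr (_ + _); have [le_ni|lt_in] := leqP n i.
  by rewrite bin_small ?mulr0n ?mulr0.
by rewrite mulrnAr -exprS -subSn // subSS.
Qed.

Section CharacterExtension.
Variables (k : fieldType) (A : comAlgType k) (I : Type).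
Variable rho : I -> {lrmorphism A -> A}.
Hypothesis k0 : [pchar k] =i pred0.
Hypothesis rho_fixed : forall a, (forall g, rho g a = a) -> exists c : k, a = c%:A.

(** Unipotence of the action, element by element: any m successive differences rho g - 1, with g
    varying, kill a. *)
Fixpoint nil_diff (m : nat) (a : A) : Prop :=
  if m is m'.+1 then forall g, nil_diff m' (rho g a - a) else a = 0.

Lemma nil_diff0 m : nil_diff m 0.
Proof. by elim: m => //= m IHm g; rewrite rmorph0 subrr. Qed.

Lemma nil_diffS m a : nil_diff m a -> nil_diff m.+1 a.
Proof.
elim: m a => [|m IHm] a; first by move=> -> g; rewrite rmorph0 subrr.
by move=> a_nil g; apply: IHm.
Qed.

Lemma nil_diff_le m n a : (m <= n)%N -> nil_diff m a -> nil_diff n a.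
Proof.
by move=> /subnK <- a_nil; elim: (n - m)%N => // d IHd; apply: nil_diffS.
Qed.

Lemma nil_diffD m a b : nil_diff m a -> nil_diff m b -> nil_diff m (a + b).
Proof.
elim: m a b => [|m IHm] a b; first by move=> -> ->; rewrite addr0.
move=> a_nil b_nil g; rewrite rmorphD /= opprD addrACA; exact: IHm.
Qed.

Lemma nil_diffZ m (c : k) a : nil_diff m a -> nil_diff m (c *: a).
Proof.
elim: m a => [|m IHm] a; first by move=> ->; rewrite scaler0.
move=> a_nil g; rewrite linearZ -scalerBr; exact: IHm (a_nil g).
Qed.

(** Twisted Leibniz rule: the difference of ab is a sum of three products, in each of which a factor
    has been replaced by its difference, so the total degree drops. *)
Lemma nil_diffM m n a b : nil_diff m a -> nil_diff n b -> nil_diff (m + n) (a * b).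
Proof.
have [d] := ubnP (m + n)%N; elim: d m n a b => // d IHd [|m] [|n] a b le_d.
- by move=> ->; rewrite mul0r.
- by move=> -> _; rewrite mul0r; exact: nil_diff0.
- by move=> _ ->; rewrite mulr0; exact: nil_diff0.
move=> a_nil b_nil; rewrite addSn => g.
have -> : rho g (a * b) - a * b = (rho g a - a) * (rho g b - b) +
    ((rho g a - a) * b + a * (rho g b - b)).
  by rewrite rmorphM /=; ring.
have lt_d : ((m + n).+1 < d)%N by move: le_d; lia.
apply: nil_diffD; first apply: (@nil_diff_le (m + n)).
- by rewrite leq_add2l.
- by apply: IHd => //; exact: ltnW.
apply: nil_diffD; first by apply: IHd; rewrite ?addnS.
by rewrite plusE addnS -addSn; apply: IHd; rewrite ?addSn.
Qed.

Definition locally_nil a := exists m, nil_diff m a.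

Lemma locally_nilD a b : locally_nil a -> locally_nil b -> locally_nil (a + b).
Proof.
move=> [m am] [n bn]; exists (maxn m n); apply: nil_diffD.
  by apply: nil_diff_le am; exact: leq_maxl.
by apply: nil_diff_le bn; exact: leq_maxr.
Qed.

Lemma locally_nilM a b : locally_nil a -> locally_nil b -> locally_nil (a * b).
Proof. by move=> [m am] [n bn]; exists (m + n)%N; exact: nil_diffM. Qed.

Lemma locally_nilC (c : k) : locally_nil c%:A.
Proof. by exists 1%N => g; rewrite alg_morphC subrr. Qed.

(* Graphs of characters of rho-stable subalgebras of locally nilpotent elements. *)
Record partial_char (Z : A * k -> Prop) : Prop := PartialChar {
  pcharC : forall c : k, Z (c%:A, c);
  pcharD : forall a b c d, Z (a, c) -> Z (b, d) -> Z (a + b, c + d);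
  pcharM : forall a b c d, Z (a, c) -> Z (b, d) -> Z (a * b, c * d);
  pchar_fun : forall c, Z (0, c) -> c = 0;
  pchar_rho : forall a c, Z (a, c) -> forall g, exists c', Z (rho g a, c');
  pchar_nil : forall a c, Z (a, c) -> locally_nil a }.

Section Extend.
Variable Z : A * k -> Prop.
Hypothesis Zchar : partial_char Z.

Definition domain a := exists c, Z (a, c).

Lemma domainC (c : k) : domain c%:A.
Proof. by exists c; exact: pcharC. Qed.
Lemma domain0 : domain 0. Proof. by rewrite -(scale0r 1); exact: domainC. Qed.
Lemma domain1 : domain 1. Proof. by rewrite -(scale1r 1); exact: domainC. Qed.
Lemma domainD a b : domain a -> domain b -> domain (a + b).
Proof. by move=> [c ac] [d bd]; exists (c + d); exact: pcharD. Qed.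
Lemma domainM a b : domain a -> domain b -> domain (a * b).
Proof. by move=> [c ac] [d bd]; exists (c * d); exact: pcharM. Qed.
Lemma domainZ (c : k) a : domain a -> domain (c *: a).
Proof. by rewrite -mulr_algl; apply: domainM; exact: domainC. Qed.
Lemma domainB a b : domain a -> domain b -> domain (a - b).
Proof. by move=> a_D b_D; rewrite -scaleN1r; apply: domainD => //; exact: domainZ. Qed.
Lemma domain_sum (J : Type) (r : seq J) (P : pred J) (F : J -> A) :
  (forall i, P i -> domain (F i)) -> domain (\sum_(i <- r | P i) F i).
Proof. by move=> FD; elim/big_ind: _ => //; [exact: domain0|exact: domainD]. Qed.
Lemma domain_rho g a : domain a -> domain (rho g a).
Proof. by move=> [c ac]; have [c' ?] := pchar_rho Zchar ac g; exists c'. Qed.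

Variable f : A.
Hypothesis f_notin : ~ domain f.
Hypothesis f_nil : locally_nil f.
Hypothesis f_diff : forall g, domain (rho g f - f).

Definition over_domain (p : {poly A}) := forall i, domain p`_i.

Lemma over_domainC a : domain a -> over_domain a%:P.
Proof. by move=> a_D i; rewrite coefC; case: eqP => // _; exact: domain0. Qed.

Lemma over_domainX : over_domain 'X.
Proof. by move=> i; rewrite coefX; case: eqP => _; [exact: domain1|exact: domain0]. Qed.

Lemma over_domainD p q : over_domain p -> over_domain q -> over_domain (p + q).
Proof. by move=> pD qD i; rewrite coefD; exact: domainD. Qed.

Lemma over_domainB p q : over_domain p -> over_domain q -> over_domain (p - q).
Proof. by move=> pD qD i; rewrite coefB; exact: domainB. Qed.

Lemma over_domainM p q : over_domain p -> over_domain q -> over_domain (p * q).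
Proof. by move=> pD qD i; rewrite coefM; apply: domain_sum => j _; exact: domainM. Qed.

(** The action of g lifted from polynomial expressions in f to polynomials: the coefficients are
    moved by rho g, and X, which stands for f, goes to X + (rho g f - f). *)
Definition shift_poly g (p : {poly A}) : {poly A} :=
  \sum_(i < size p) (rho g p`_i)%:P * ('X + (rho g f - f)%:P) ^+ i.

Lemma over_domain_shift g p : over_domain p -> over_domain (shift_poly g p).
Proof.
move=> pD; rewrite /shift_poly; elim/big_ind: _ => [||i _].
- exact: over_domainC domain0.
- exact: over_domainD.
apply: over_domainM; first exact/over_domainC/domain_rho.
elim: (i : nat) => [|m IHm]; first exact: over_domainC domain1.
rewrite exprS; apply: over_domainM => //; apply: over_domainD; last exact: over_domainC.
exact: over_domainX.
Qed.

Lemma shift_poly_horner g p : (shift_poly g p).[f] = rho g p.[f].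
Proof.
rewrite horner_sum [in RHS]horner_coef rmorph_sum; apply: eq_bigr => i _.
by rewrite hornerCM horner_exp hornerD hornerX hornerC [f + _]addrC subrK rmorphM rmorphXn.
Qed.

Lemma coef_shift_poly g p j : (shift_poly g p)`_j =
  \sum_(i < size p) rho g p`_i * (rho g f - f) ^+ (i - j) *+ 'C(i, j).
Proof.
rewrite coef_sum; apply: eq_bigr => i _.
by rewrite coefCM coef_XaddCX mulrnAr.
Qed.

Lemma coef_shift_poly_top g (p : {poly A}) n : (size p <= n.+1)%N ->
  (shift_poly g p)`_n = rho g p`_n.
Proof.
move=> le_pn; rewrite coef_shift_poly.
rewrite (big_ord_widen n.+1 (fun i => rho g p`_i * (rho g f - f) ^+ (i - n) *+ 'C(i, n))) //.
rewrite big_mkcond big_ord_recr /= big1 ?add0r => [|i _]; last first.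
  by case: ifP => // _; rewrite bin_small ?mulr0n.
rewrite subnn expr0 mulr1 binn mulr1n; case: ltnP => // le_pn'.
by rewrite nth_default ?rmorph0.
Qed.

Lemma size_shift_poly g (p : {poly A}) : (size (shift_poly g p) <= size p)%N.
Proof.
apply/leq_sizeP=> j le_pj; rewrite coef_shift_poly big1 // => i _.
by rewrite bin_small ?mulr0n // (leq_trans (ltn_ord i)).
Qed.

Lemma coef_shift_poly_monic g (p : {poly A}) n : size p = n.+2 -> p`_n.+1 = 1 ->
  (shift_poly g p)`_n = rho g p`_n + (rho g f - f) *+ n.+1.
Proof.
move=> sz_p p1; rewrite coef_shift_poly sz_p !big_ord_recr /= big1 ?add0r => [|i _].
  rewrite subnn expr0 mulr1 binn mulr1n p1 rmorph1 mul1r subSnn expr1.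
  by rewrite binSn.
by rewrite bin_small ?mulr0n.
Qed.

(* A minimal relation may be taken monic, by the simplicity of the domain under
   translations; comparing it with its translates shows that its second
   coefficient plus n f is invariant, so that f is in the domain. *)
Lemma no_relation p : over_domain p -> p.[f] = 0 -> p = 0.
Proof.
have [d] := ubnP (size p); elim: d p => // d IHd p; rewrite ltnS => le_pd pD pf.
have [//|p_nz] := eqVneq p 0; case: (f_notin).
have [n sz_p] : exists n, size p = n.+1.
  by exists (size p).-1; rewrite prednK // size_poly_gt0.
pose J a := exists q, [/\ over_domain q, (size q <= n.+1)%N, q.[f] = 0 & q`_n = a].
have J_diff g a : J a -> J (rho g a - a).
  move=> [q [qD sz_q qf <-]]; exists (shift_poly g q - q); split.
  - by apply: over_domainB => //; exact: over_domain_shift.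
  - rewrite (leq_trans (size_polyD _ _)) // geq_max size_polyN sz_q andbT.
    exact: leq_trans (size_shift_poly _ _) sz_q.
  - by rewrite hornerD hornerN shift_poly_horner qf rmorph0 subrr.
  - by rewrite coefB coef_shift_poly_top.
(* J collects the coefficients in degree n of relations of degree at most n. Differences of a
   nonzero element stay in J and end at a nonzero invariant, which is a constant and can be scaled
   to 1. *)
have J1 m a : nil_diff m a -> a <> 0 -> J a -> J 1.
  elim: m a => // m IHm a a_nil a_nz Ja.
  have [a_fix|/existsNP[g ga]] := pselect (forall g, rho g a = a); last first.
    by apply: IHm (a_nil g) _ (J_diff g _ Ja) => /eqP; rewrite subr_eq0 => /eqP.
  have [c Da] := rho_fixed a_fix.
  have c_nz : c != 0 by apply/eqP=> c0; rewrite Da c0 scale0r in a_nz.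
  have [q [qD sz_q qf qa]] := Ja; exists ((c^-1%:A)%:P * q); split.
  - by apply: over_domainM => //; exact/over_domainC/domainC.
  - by rewrite mul_polyC (leq_trans (size_scale_leq _ _)).
  - by rewrite hornerCM qf mulr0.
  - by rewrite coefCM qa Da mulr_algl scalerA mulVf ?scale1r.
have [q [qD sz_q qf q1]] : J 1.
  have [c pc] := pD n; have [m pm] := pchar_nil Zchar pc.
  apply: (J1 m p`_n) => //; last by exists p; split; rewrite ?sz_p.
  by apply/eqP; have := lead_coef_eq0 p; rewrite lead_coefE sz_p => ->.
have {}sz_q : size q = n.+1.
  apply/eqP; rewrite eqn_leq sz_q ltnNge; apply/negP=> le_qn.
  by have /eqP := q1; rewrite nth_default // eq_sym oner_eq0.
case: n sz_q => [|n] sz_q in sz_p q1 J J_diff J1 *.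
  by have /eqP := qf; rewrite (size1_polyC (eq_leq sz_q)) hornerC q1 oner_eq0.
have [g|c Dc] := @rho_fixed (q`_n + f *+ n.+1).
  have r0 : shift_poly g q - q = 0.
    apply: IHd; last by rewrite hornerD hornerN shift_poly_horner qf rmorph0 subrr.
      have: (size (shift_poly g q - q)%R <= n.+1)%N; last by move=> h; apply: leq_ltn_trans h _; rewrite -sz_p.
      apply/leq_sizeP=> j; rewrite leq_eqVlt => /predU1P[<-|lt_nj].
        by rewrite coefB coef_shift_poly_top ?sz_q // q1 rmorph1 subrr.
      rewrite nth_default // (leq_trans (size_polyD _ _)) // geq_max size_polyN sz_q lt_nj andbT.
      by rewrite (leq_trans (size_shift_poly _ _)) ?sz_q.
    by apply: over_domainB => //; exact: over_domain_shift.
  have := congr1 (fun r : {poly A} => r`_n) r0.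
  rewrite coef0 coefB (coef_shift_poly_monic _ sz_q) // => /eqP; rewrite subr_eq0 => /eqP.
  by move=> Dq; rewrite rmorphD rmorphMn /= -[in RHS]Dq mulrnBl -addrA subrK.
have -> : f = (n.+1%:R : k)^-1 *: (c%:A - q`_n).
  rewrite -Dc addrC addKr -scaler_nat scalerA mulVf ?scale1r //.
  exact: char0_natr_neq0.
by apply/domainZ/domainB; [exact: domainC | exact: qD].
Qed.

(** By [no_relation] the domain with f adjoined is a polynomial ring, so the value at f is free. The
    choice is 0, whence p.[f] gets the value of the constant coefficient of p. *)
Lemma extend_char : exists Z' : A * k -> Prop,
  [/\ partial_char Z', forall x, Z x -> Z' x & exists c, Z' (f, c)].
Proof.
pose Z' (x : A * k) := exists p, [/\ over_domain p, p.[f] = x.1 & Z (p`_0, x.2)].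
exists Z'; split=> [|[a c] ac|]; last first.
- exists 0; exists 'X; rewrite hornerX coefX; split=> //.
    exact: over_domainX.
  by have := pcharC Zchar 0; rewrite scale0r.
- exists a%:P; rewrite hornerC coefC; split=> //.
  by apply: over_domainC; exists c.
split.
- move=> c; exists (c%:A)%:P; rewrite hornerC coefC; split=> //.
    exact/over_domainC/domainC.
  exact: pcharC.
- move=> a b c d [p [pD /= <- pc]] [q [qD /= <- qd]]; exists (p + q).
  rewrite hornerD coefD; split=> //; first exact: over_domainD.
  exact: pcharD.
- move=> a b c d [p [pD /= <- pc]] [q [qD /= <- qd]]; exists (p * q).
  rewrite hornerM coef0M; split=> //; first exact: over_domainM.
  exact: pcharM.
- move=> c [p [pD /= /no_relation-> //]]; rewrite coef0; exact: pchar_fun.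
- move=> a c [p [pD /= <- pc]] g.
  have sD := over_domain_shift g pD; have [c' sc'] := sD 0%N.
  by exists c'; exists (shift_poly g p); rewrite shift_poly_horner.
move=> a c [p [pD /= <- _]]; rewrite horner_coef; elim/big_ind: _ => [||i _].
- by exists 0%N.
- exact: locally_nilD.
apply: locally_nilM; first by have [c' /(pchar_nil Zchar)] := pD i.
elim: (i : nat) => [|m IHm]; first by rewrite expr0 -(scale1r 1); exact: locally_nilC.
by rewrite exprS; exact: locally_nilM.
Qed.

End Extend.

(** As long as some difference of a is outside the domain, a is replaced by it. Local nilpotence
    stops the process, since 0 is in the domain. *)
Lemma exists_step (Z : A * k -> Prop) a : partial_char Z -> locally_nil a -> ~ domain Z a ->
  exists f, [/\ locally_nil f, ~ domain Z f & forall g, domain Z (rho g f - f)].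
Proof.
move=> Zchar [m]; elim: m a => [|m IHm] a a_nil a_out.
  by case: a_out; rewrite a_nil; exact: domain0.
have [aD|/existsNP[g]] := pselect (forall g, domain Z (rho g a - a)).
  by exists a; split=> //; exists m.+1.
exact: IHm (a_nil g).
Qed.

Lemma char_extension (Z : A * k -> Prop) : partial_char Z ->
  exists Z' : A * k -> Prop, [/\ partial_char Z', forall x, Z x -> Z' x &
    forall a, locally_nil a -> exists c, Z' (a, c)].
Proof.
move=> Zchar.
(* Zorn is applied to the sets X to be added to Z rather than to characters containing Z, so that
   the empty chain has an upper bound too. *)
pose P (X : classical_sets.set (A * k)) := partial_char (fun x => Z x \/ X x).
have [F FP Ftot|X [XP Xmax]] := @classical_sets.Zorn_bigcup _ P.
  pose W X (x : A * k) := Z x \/ X x.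
  pose U := classical_sets.bigcup F id.
  have one x : W U x -> exists X, [/\ partial_char (W X), W X x & forall y, W X y -> W U y].
    case=> [Zx|[X FX Xx]].
      exists classical_sets.set0; split; [|by left|by move=> y [Zy|//]; left].
      rewrite (_ : W _ = Z) //; apply/funext=> y; apply/propext; split; last by left.
      by case.
    exists X; split; [exact: FP|by right|]; move=> y [Zy|Xy]; [by left|right].
    by exists X.
  have two x y : W U x -> W U y ->
      exists X, [/\ partial_char (W X), W X x, W X y & forall z, W X z -> W U z].
    move=> Ux [Zy|[Y FY Yy]].
      by have [X [? ? ?]] := one x Ux; exists X; split=> //; left.
    have YU z : W Y z -> W U z by case=> [Zz|Yz]; [left|right; exists Y].
    case: Ux => [Zx|[X FX Xx]].
      by exists Y; split=> //; [exact: FP|left|right].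
    have XU z : W X z -> W U z by case=> [Zz|Xz]; [left|right; exists X].
    case: (Ftot X Y FX FY) => sub.
      by exists Y; split=> //; [exact: FP|right; exact: sub|right].
    by exists X; split=> //; [exact: FP|right|right; exact: sub].
  split.
  - by move=> c; left; exact: pcharC.
  - move=> a b c d ac bd; have [X [Xc Xac Xbd]] := two _ _ ac bd; apply.
    exact: (pcharD Xc).
  - move=> a b c d ac bd; have [X [Xc Xac Xbd]] := two _ _ ac bd; apply.
    exact: (pcharM Xc).
  - by move=> c /one[X [Xc Xac _]]; exact: (pchar_fun Xc).
  - move=> a c /one[X [Xc Xac XU]] g.
    by have [c' ac'] := pchar_rho Xc Xac g; exists c'; exact: XU.
  - by move=> a c /one[X [Xc Xac _]]; exact: (pchar_nil Xc Xac).
exists (fun x => Z x \/ X x); split=> // [x|a a_nil]; first by left.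
apply: contrapT => a_out.
have [f [f_nil f_out f_diff]] := exists_step XP a_nil a_out.
have [Z' [Z'c ZZ' [c Z'f]]] := extend_char XP f_out f_nil f_diff.
apply: (Xmax Z').
  split; first by move=> x Xx; apply: ZZ'; right.
  by move=> /(_ _ Z'f) Xf; apply: f_out; exists c; right.
rewrite /P (_ : (fun x => _) = Z') //; apply/funext=> x; apply/propext.
by split=> [[Zx|//]|]; [apply: ZZ'; left|right].
Qed.

End CharacterExtension.

(** * Surjectivity onto closed images *)

Section SubalgebraType.
Variables (k : fieldType) (A : comAlgType k) (B : A -> Prop).
Hypothesis B_const : forall c : k, B c%:A.
Hypothesis B_add : forall f g, B f -> B g -> B (f + g).
Hypothesis B_mul : forall f g, B f -> B g -> B (f * g).

Let Bp : {pred A} := fun a => `[< B a >].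

Let Bp_subalg : GRing.subalg_closed Bp.
Proof.
split; first by apply/asboolP; rewrite -(scale1r 1).
  move=> c f g /asboolP Bf /asboolP Bg; apply/asboolP/B_add => //.
  by rewrite -mulr_algl; apply: B_mul.
by move=> f g /asboolP Bf /asboolP Bg; apply/asboolP/B_mul.
Qed.

#[local] HB.instance Definition _ := GRing.isSubalgClosed.Build k A Bp Bp_subalg.

Record subalg_type := SubalgType { subalg_val : A; _ : subalg_val \in Bp }.
#[local] HB.instance Definition _ := [isSub for subalg_val].
#[local] HB.instance Definition _ := [Choice of subalg_type by <:].
#[local] HB.instance Definition _ := [SubChoice_isSubAlgebra of subalg_type by <:].
#[local] HB.instance Definition _ := [SubNzRing_isSubComNzRing of subalg_type by <:].

Lemma subalg_type_ex : exists (T : comAlgType k) (v : {lrmorphism T -> A}),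
  injective v /\ forall a, B a <-> exists t, v t = a.
Proof.
have [v vE] : {v : {lrmorphism subalg_type -> A} | v =1 subalg_val}.
  by apply: alg_morph.
exists subalg_type, v; split; first by move=> x y; rewrite !vE => /val_inj.
move=> a; split=> [Ba|[x <-]]; last first.
  by rewrite vE; have /asboolP := valP x.
have Ba' : a \in Bp by exact/asboolP.
by exists (SubalgType Ba'); rewrite vE.
Qed.

End SubalgebraType.

(* The coordinate algebra of a prounipotent group is generated by the matrix
   coefficients of its unipotent quotients: the subalgebra they generate already
   carries a point of the group, by the universal property of the limit. *)
Lemma prounipotent_ind (k : fieldType) (G : affineGroup k) (B : coordAlg G -> Prop) :
  prounipotent G ->
  (forall c : k, B c%:A) ->
  (forall f g, B f -> B g -> B (f + g)) ->
  (forall f g, B f -> B g -> B (f * g)) ->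
  (forall (n : nat) (M : 'M[coordAlg G]_n),
    (forall i j : 'I_n, (j < i)%N -> M i j = 0) ->
    (forall i : 'I_n, M i i = 1) ->
    (forall (R : comAlgType k) (p q : pts G R),
       map_mx (ev G (p * q)%g) M = map_mx (ev G p) M *m map_mx (ev G q) M) ->
    forall i j, B (M i j)) ->
  forall f, B f.
Proof.
move=> [I [le [V [tr [pr [_ [_ _ _] V_unip [_ _ tr_pr] G_lim]]]]]] BC BD BM Bmx.
have pr_inj (R : comAlgType k) (x y : pts G R) :
    (forall i, pr i R x = pr i R y) -> x = y.
  move=> xy; have [i j e|z [_ z_uniq]] := G_lim R (fun i => pr i R y).
    exact: tr_pr.
  by rewrite -(z_uniq x xy) -(z_uniq y).
have BV i f : B (pullback (pr i) f).
  have [n [M [M_low M_diag MM M_gen]]] := V_unip i.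
  apply: (M_gen (fun f => B (pullback (pr i) f))) f => [c|f g|f g|a b].
  - by rewrite alg_morphC.
  - by rewrite rmorphD; exact: BD.
  - by rewrite rmorphM; exact: BM.
  have := Bmx n (map_mx (pullback (pr i)) M) _ _ _ a b; rewrite mxE; apply.
  - by move=> c d lt_dc; rewrite mxE M_low ?rmorph0.
  - by move=> c; rewrite mxE M_diag rmorph1.
  have evM (R : comAlgType k) (p : pts G R) :
      map_mx (ev G p) (map_mx (pullback (pr i)) M) = map_mx (ev (V i) (pr i R p)) M.
    by apply/matrixP=> c d; rewrite !mxE ev_hom.
  by move=> R p q; rewrite !evM gmulfM MM.
have [T [v [v_inj vB]]] := subalg_type_ex BC BD BM.
have x_ex i : {x : pts (V i) T | forall f, v (ev (V i) x f) = pullback (pr i) f}.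
  apply: cid; have /choice[u uP] f : exists t, v t = pullback (pr i) f by exact/vB.
  have [u' u'E] : {u' : {lrmorphism coordAlg (V i) -> T} | u' =1 u}.
    apply: alg_morph => [f g|f g|c]; apply: v_inj.
    - by rewrite rmorphD /= !uP rmorphD.
    - by rewrite rmorphM /= !uP rmorphM.
    - by rewrite uP !alg_morphC.
  by have [p pE] := pt_of u'; exists p => f; rewrite pE u'E uP.
pose x i := sval (x_ex i); have xP i := svalP (x_ex i).
have [i j e|g [gx _]] := G_lim T x.
  apply: ev_inj => f; apply: v_inj; rewrite xP ev_hom xP.
  by rewrite -[LHS]ev_univ -[RHS]ev_univ -!ev_hom tr_pr.
have gE : bc G v g = univ G.
  apply: pr_inj => i; rewrite hom_nat gx; apply: ev_inj => f.
  by rewrite ev_bcE xP ev_hom ev_univ.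
by move=> f; apply/vB; exists (ev G g f); rewrite -ev_bcE gE ev_univ.
Qed.

Section FunctionAlgebra.
Variables (k : fieldType) (T : pointedType).

Definition funAlg : Type := T -> k^o.
HB.instance Definition _ := GRing.ComNzRing.copy funAlg (T -> k^o).
HB.instance Definition _ := GRing.Lmodule.copy funAlg (T -> k^o).

Fact funAlg_scaleAl (c : k) (f g : funAlg) : c *: (f * g) = c *: f * g.
Proof. by apply/funext=> x; exact: mulrA. Qed.
HB.instance Definition _ := GRing.Lmodule_isLalgebra.Build k funAlg funAlg_scaleAl.
Fact funAlg_scaleAr (c : k) (f g : funAlg) : c *: (f * g) = f * (c *: g).
Proof. by apply/funext=> x; exact: mulrCA. Qed.
HB.instance Definition _ := GRing.Lalgebra_isAlgebra.Build k funAlg funAlg_scaleAr.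

Lemma funAlgC (c : k) (x : T) : (c%:A : funAlg) x = c.
Proof. exact: mulr1. Qed.

Lemma funAlg_sum (I : Type) (r : seq I) (P : pred I) (F : I -> funAlg) (x : T) :
  (\sum_(i <- r | P i) F i) x = \sum_(i <- r | P i) F i x.
Proof. by elim/big_rec2: _ => // i a b _ <-. Qed.

End FunctionAlgebra.

Section ClosedImage.
Variables (k : fieldType) (G H : affineGroup k) (f : grpHom G H).
Variable N : forall R : comAlgType k, pts G R -> Prop.
Hypotheses (k0 : [pchar k] =i pred0) (G_pro : prounipotent G).
Hypothesis N1 : N (1%g : pts G k^o).
Hypothesis NM : forall x y : pts G k^o, N x -> N y -> N (x * y)%g.
Hypothesis N_dense : forall a : coordAlg G,
  (forall x : pts G k^o, N x -> ev G x a = 0) ->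
  forall (R : comAlgType k) (x : pts G R), N x -> ev G x a = 0.

Let Npt := {x : pts G k^o | N x}.
#[local] HB.instance Definition _ := gen_eqMixin Npt.
#[local] HB.instance Definition _ := gen_choiceMixin Npt.
#[local] HB.instance Definition _ := isPointed.Build Npt (exist _ 1%g N1).

Let mulN (x y : Npt) : Npt := exist _ (sval x * sval y)%g (NM (svalP x) (svalP y)).

Let restr_subproof : {r : {lrmorphism coordAlg G -> funAlg k Npt} |
  forall a x, r a x = ev G (sval x) a}.
Proof.
have [r rE] : {r : {lrmorphism coordAlg G -> funAlg k Npt} |
    r =1 fun a x => ev G (sval x) a}.
  apply: alg_morph => [a b|a b|c]; apply/funext=> x.
  - by rewrite rmorphD.
  - by rewrite rmorphM.
  - by rewrite alg_morphC.
by exists r => a x; rewrite rE.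
Qed.
Let restr := sval restr_subproof.
Let restrE a x : restr a x = ev G (sval x) a.
Proof. exact: (svalP restr_subproof). Qed.

Let rho_subproof g : {r : {lrmorphism funAlg k Npt -> funAlg k Npt} |
  forall a x, r a x = a (mulN x g)}.
Proof.
have [r rE] : {r : {lrmorphism funAlg k Npt -> funAlg k Npt} |
    r =1 fun a x => a (mulN x g)}.
  by apply: alg_morph => [a b|a b|c]; apply/funext=> x.
by exists r => a x; rewrite rE.
Qed.
Let rho g := sval (rho_subproof g).
Let rhoE g a x : rho g a x = a (mulN x g).
Proof. exact: (svalP (rho_subproof g)). Qed.

Let rho_fixed a : (forall g, rho g a = a) -> exists c : k, a = c%:A.
Proof.
move=> a_fix; exists (a point); apply/funext=> x; rewrite funAlgC.
have := congr1 (fun h : funAlg k Npt => h point) (a_fix x); rewrite rhoE => <-.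
congr a; case: x => x Nx; apply: eq_exist.
by rewrite /= mul1g.
Qed.

(** Right translation changes the entry M i j of a unitriangular matrix by a combination of entries
    M i l with l < j, so j.+1 differences kill it. Other regular functions are polynomials in such
    entries. *)
Let restr_nil a : locally_nil rho (restr a).
Proof.
move: a; apply: (prounipotent_ind G_pro) => [c|a b|a b|n M M_low M_diag MM i j].
- by rewrite alg_morphC; exact: locally_nilC.
- by rewrite rmorphD; exact: locally_nilD.
- by rewrite rmorphM; exact: locally_nilM.
exists j.+1; have [d] := ubnP j; elim: d j => // d IHd j; rewrite ltnS => le_jd g.
have -> : rho g (restr (M i j)) - restr (M i j) =
    \sum_(l < n | (l < j)%N) (ev G (sval g) (M l j) : k) *: restr (M i l).
  apply/funext=> x; rewrite funAlg_sum.
  transitivity (ev G (sval x * sval g)%g (M i j) - ev G (sval x) (M i j)).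
    by rewrite -[LHS]/(rho g (restr (M i j)) x - restr (M i j) x) rhoE !restrE.
  have /matrixP/(_ i j) := MM _ (sval x) (sval g); rewrite !mxE => ->.
  rewrite (bigID (fun l : 'I_n => (l < j)%N)) /= [X in _ + X - _](bigD1 j) ?ltnn //=.
  rewrite !mxE M_diag rmorph1 mulr1 [X in _ + (_ + X) - _]big1 ?addr0 ?addrK.
    by apply: eq_bigr => l _; rewrite !mxE -restrE mulrC.
  move=> l /andP[]; rewrite -leqNgt leq_eqVlt => /predU1P[/val_inj->|lt_jl].
    by rewrite eqxx.
  by rewrite !mxE (M_low l j) // rmorph0 mulr0.
elim/big_ind: _ => [||l lt_lj]; [exact: nil_diff0|exact: nil_diffD|].
by apply/nil_diffZ/(nil_diff_le lt_lj)/IHd; exact: leq_trans le_jd.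
Qed.

(** Evaluation at y is a character on the functions pulled back from H and restricted to the
    k-points of N; the hypothesis on y makes it well defined. An extension to the restrictions of
    all regular functions on G is a point x, and x lies in the closure of these k-points because its
    character factors through restriction to them. *)
Lemma closed_image_lift (y : pts H k^o) : closed_image f N y ->
  exists x : pts G k^o, f k^o x = y /\
    forall a, (forall x', N (x' : pts G k^o) -> ev G x' a = 0) -> ev G x a = 0.
Proof.
move=> y_im.
pose Z0 (z : funAlg k Npt * k) := exists b, restr (pullback f b) = z.1 /\ ev H y b = z.2.
have Z0c : partial_char rho Z0.
  split.
  - by move=> c; exists c%:A; rewrite !alg_morphC; split=> //; exact: mulr1.
  - move=> a b c d [u [/= <- <-]] [v [/= <- <-]]; exists (u + v).
    by rewrite !rmorphD.
  - move=> a b c d [u [/= <- <-]] [v [/= <- <-]]; exists (u * v).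
    by rewrite !rmorphM.
  - move=> c [b [/= b0 <-]]; apply: y_im => R x Nx; rewrite ev_hom.
    apply: N_dense Nx => x' Nx'.
    by have /(congr1 (fun h : funAlg k Npt => h (exist _ x' Nx'))) := b0; rewrite restrE.
  - move=> a c [b [/= <- _]] g.
    (* The right translate of b by the k-point f g, as a regular function on H: it shows that the
       domain of Z0 is stable under translation by g. *)
    pose tb := ev H (univ H * bc H (scalar_lr _) (f k^o (sval g)))%g b.
    have tbE z : ev H z tb = ev H (z * f k^o (sval g))%g b.
      rewrite -ev_bcE gmulfM bc_univ bc_bc; congr (ev H (_ * _)%g b).
      by apply: bc_id => c'; rewrite /= scalar_lrE alg_morphC; exact: mulr1.
    exists (ev H y tb); exists tb; split=> //=; apply/funext=> x.
    by rewrite rhoE !restrE -!ev_hom tbE gmulfM.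
  - by move=> a c [b [/= <- _]]; exact: restr_nil.
have [Z [Zc Z0Z Z_ex]] := char_extension k0 rho_fixed Z0c.
have Z_fun a c d : Z (a, c) -> Z (a, d) -> c = d.
  move=> ac ad; apply/eqP; rewrite -subr_eq0; apply/eqP/(pchar_fun Zc).
  have := pcharD Zc ac (pcharM Zc (pcharC Zc (-1)) ad).
  by rewrite mulN1r scaleN1r mulN1r subrr.
have /choice[c cP] a : exists c, Z (restr a, c) by apply: Z_ex; exact: restr_nil.
have [c' c'E] : {c' : {lrmorphism coordAlg G -> k^o} | c' =1 c}.
  apply: alg_morph => [a b|a b|d]; apply: Z_fun (cP _) _.
  - by rewrite rmorphD; exact: (pcharD Zc (cP a) (cP b)).
  - by rewrite rmorphM; exact: (pcharM Zc (cP a) (cP b)).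
  - by rewrite alg_morphC /GRing.scale /= mulr1; exact: (pcharC Zc).
have [x xE] := pt_of c'; exists x; split.
  apply: ev_inj => b; rewrite ev_hom xE c'E.
  by apply: Z_fun (cP _) _; apply: Z0Z; exists b.
move=> a a0; rewrite xE c'E; apply: Z_fun (cP _) _.
have -> : restr a = 0.
  by apply/funext=> x'; rewrite restrE a0 //; exact: svalP x'.
by have := pcharC Zc 0; rewrite scale0r.
Qed.

End ClosedImage.

(** * Fillers in simplicial prounipotent groups *)

Section SimplicialGroup.
Variables (k : fieldType) (X : simplicialGroup k).

Definition horn_compat (R : comAlgType k) q n : (nat -> pts (X n) R) -> Prop :=
  match n with
  | 0 => fun _ => True
  | m.+1 => fun y => forall i j, (i <= j <= m.+1)%N -> i != q -> j.+1 != q ->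
      face X m i R (y j.+1) = face X m j R (y i)
  end.

(** Multiplying w by a degeneracy of (d_t w)^-1 y_t corrects its face t. This lemma and the next say
    that faces which are already right are not disturbed; s is t or t - 1, according to the
    direction in which the faces are treated. *)
Lemma face_corr_above (R : comAlgType k) n (w : pts (X n.+1) R) (y : nat -> pts (X n) R) q t s j :
  horn_compat q y -> t != q -> j != q -> (t < j <= n.+1)%N -> (s < j.-1)%N -> (s <= t)%N ->
  (s <= n)%N ->
  face X n j R w = y j ->
  face X n j R (deg X n s R ((face X n t R w)^-1 * y t)%g) = 1%g.
Proof.
case: n => [|n] in w y *; first by case: j => [|[|j]] //=; lia.
case: j => // j /= compat t_q j_q /andP[lt_tj le_jn] lt_sj le_st le_sn wj.
rewrite face_deg_gt ?lt_sj // gmulfM multiplicativeV -face_face ?lt_tj //.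
rewrite wj compat ?mulVg ?multiplicative1 //.
all: lia.
Qed.

Lemma face_corr_below (R : comAlgType k) n (w : pts (X n.+1) R) (y : nat -> pts (X n) R) q t j :
  horn_compat q y -> t != q -> j != q -> (j < t <= n)%N ->
  face X n j R w = y j ->
  face X n j R (deg X n t R ((face X n t R w)^-1 * y t)%g) = 1%g.
Proof.
case: n => [|n] in w y *; first by lia.
case: t => // t /= compat t_q j_q /andP[lt_jt le_tn] wj.
have le_jtn : (j <= t <= n)%N by lia.
have le_jtn' : (j <= t <= n.+1)%N by lia.
rewrite face_deg_lt // gmulfM multiplicativeV face_face //.
by rewrite wj compat // mulVg multiplicative1.
Qed.

(** Moore's argument that simplicial groups are Kan. Faces above q are corrected from the top down
    using s_(t-1), then those below q from 0 up using s_t. Besides face t, a correction disturbs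
    only face t - 1 or t + 1 respectively, which is the missing one or not yet treated. *)
Lemma horn_filler (R : comAlgType k) n (y : nat -> pts (X n) R) q :
  (q <= n.+1)%N -> horn_compat q y ->
  exists w, forall i, (i <= n.+1)%N -> i != q -> face X n i R w = y i.
Proof.
move=> le_qn compat.
have above t : (t + q <= n.+1)%N -> exists w : pts (X n.+1) R,
    forall j, (n.+1 - t < j <= n.+1)%N -> face X n j R w = y j.
  elim: t => [|t IHt] le_t; first by exists 1%g => j; lia.
  have [|w wP] := IHt; first by lia.
  set s := (n - t)%N.
  have Ds : (n.+1 - t = s.+1)%N by rewrite /s; lia.
  exists (w * deg X n s R ((face X n s.+1 R w)^-1 * y s.+1))%g => j le_j.
  rewrite gmulfM; have [Dj|ne_j] := eqVneq j s.+1.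
    by rewrite Dj face_deg_eqS ?mulKVg //; rewrite /s; lia.
  rewrite (@face_corr_above R n w y q) ?mulg1 ?wP //; try (rewrite /s; lia).
suff /(_ q (leqnn q)) [w wP] : forall t, (t <= q)%N -> exists w : pts (X n.+1) R,
    forall j, (j <= n.+1)%N -> (j < t)%N || (q < j)%N -> face X n j R w = y j.
  by exists w => i le_i ne_i; apply: wP => //; lia.
elim=> [|t IHt] le_tq.
  have [|w wP] := above (n.+1 - q)%N; first by lia.
  by exists w => j le_j lt_qj; apply: wP; lia.
have [|w wP] := IHt; first by lia.
exists (w * deg X n t R ((face X n t R w)^-1 * y t))%g => j le_j lt_j.
rewrite gmulfM; have [Dj|ne_j] := eqVneq j t.
  by rewrite Dj face_deg_eq ?mulKVg //; lia.
have [lt_jt|le_tj] := ltnP j t.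
  by rewrite (@face_corr_below R n w y q) ?mulg1 ?wP //; lia.
by rewrite (@face_corr_above R n w y q) ?mulg1 ?wP //; lia.
Qed.

(* Kills the faces d_{n+1}, ..., d_1 in turn. *)
Fixpoint moore_retract n t (R : comAlgType k) (x : pts (X n.+1) R) : pts (X n.+1) R :=
  if t is t'.+1 then
    let x' := moore_retract t' x in
    (x' * deg X n (n - t') R (face X n (n - t').+1 R x')^-1)%g
  else x.

Lemma moore_retract_bc n t (R R' : comAlgType k) (u : {lrmorphism R -> R'})
    (x : pts (X n.+1) R) :
  moore_retract t (bc (X n.+1) u x) = bc (X n.+1) u (moore_retract t x).
Proof.
elim: t => //= t IHt; rewrite gmulfM IHt; congr (_ * _)%g.
by rewrite hom_nat -multiplicativeV hom_nat.
Qed.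

Lemma moore_retract_face n t (R : comAlgType k) (x : pts (X n.+1) R) :
  (t <= n.+1)%N -> forall j, (n.+1 - t < j <= n.+1)%N ->
  face X n j R (moore_retract t x) = 1%g.
Proof.
elim: t => [|t IHt] le_tn j le_j /=; first by lia.
set w := moore_retract t x in IHt *; set s := (n - t)%N.
rewrite gmulfM; have [->|ne_j] := eqVneq j s.+1.
  by rewrite face_deg_eqS ?mulgV // /s; lia.
rewrite -[Z in deg X n s R Z]mulg1.
rewrite (@face_corr_above R n w (fun=> 1%g) 0) ?IHt ?mulg1 //; try (rewrite /s; lia).
by case: n {x w s IHt le_tn le_j ne_j} => //= n i i' _ _ _; rewrite !multiplicative1.
Qed.

Lemma moore_retract_moore n (R : comAlgType k) (x : pts (X n.+1) R) :
  moore (moore_retract n.+1 x).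
Proof. by move=> i le_i; apply: moore_retract_face; lia. Qed.

Lemma moore_retract_id n t (R : comAlgType k) (x : pts (X n.+1) R) :
  (t <= n.+1)%N -> moore x -> moore_retract t x = x.
Proof.
move=> le_tn x_moore; elim: t le_tn => //= t IHt le_tn.
rewrite IHt; last by lia.
by rewrite x_moore ?invg1 ?multiplicative1 ?mulg1 //; lia.
Qed.

(** The retraction need not be a homomorphism; its naturality in R is enough to make its composite
    with [a] a regular function. *)
Lemma moore_dense n (a : coordAlg (X n.+1)) :
  (forall b : coordAlg (X n.+1),
    (forall x : pts (X n.+1) k^o, ev (X n.+1) x b = 0) -> b = 0) ->
  (forall x : pts (X n.+1) k^o, moore x -> ev (X n.+1) x a = 0) ->
  forall (R : comAlgType k) (x : pts (X n.+1) R), moore x -> ev (X n.+1) x a = 0.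
Proof.
move=> dense a0 R x x_moore.
have retrE (R' : comAlgType k) (z : pts (X n.+1) R') :
    ev (X n.+1) (moore_retract n.+1 z) a =
    ev (X n.+1) z (ev (X n.+1) (moore_retract n.+1 (univ (X n.+1))) a).
  by rewrite -ev_bcE -moore_retract_bc bc_univ.
rewrite -(moore_retract_id (leqnn _) x_moore).
rewrite retrE [b in ev _ x b]dense ?rmorph0 // => z.
by rewrite -retrE a0 //; exact: moore_retract_moore.
Qed.

End SimplicialGroup.

(** * Exactness of a resolution on k-points *)

Section Resolution.
Variables (k : fieldType) (G : prounipGroup k) (X : freeResolution G).
Hypothesis k0 : [pchar k] =i pred0.

Lemma res_dense n (a : coordAlg (X n)) :
  (forall x : pts (X n) k^o, ev (X n) x a = 0) -> a = 0.
Proof. by move=> a0; apply: (free_gen_dense k0 (@gen_free k G X n)) => l. Qed.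

Lemma aug_surj (g : pts G k^o) : exists x : pts (X 0) k^o, aug X k^o x = g.
Proof.
have [q_im _] := pi0_res X.
have lift := @closed_image_lift k (X 0) G (aug X) (fun R _ => True) k0 (pu_prounip _) I
  (fun x y _ _ => I).
have [a a0 R x _||x [xg _]] := lift _ g; last by exists x.
  by rewrite (res_dense (fun x' => a0 x' I)) rmorph0.
exact: q_im.
Qed.

(** In degree 0 the augmentation serves as differential, so that exactness at X_0 is treated
    together with the higher degrees. *)
Definition is_cycle n : pts (X n) k^o -> Prop :=
  match n with
  | 0 => fun x => aug X k^o x = 1%g
  | m.+1 => fun x => forall i, (i <= m.+1)%N -> face X m i k^o x = 1%g
  end.

Lemma moore_bound n (y : pts (X n) k^o) : is_cycle y ->
  exists2 x : pts (X n.+1) k^o, moore x & face X n 0 k^o x = y.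
Proof.
move=> y_cycle; have y_bd : moore_boundary y.
  case: n y y_cycle => [|n] y y_cycle.
    by have [_ pi0] := pi0_res X; apply/pi0.
  refine (@pin_res _ _ X n.+1 isT k^o y _); split; last exact: y_cycle.
  by move=> i /andP[_ le_i]; exact: y_cycle.
have [|x z Nx Nz i le_i|a a0 R x|x [xy x_cl]] := closed_image_lift k0 (pu_prounip _) _ _ _ y_bd.
- by move=> i _; exact: multiplicative1.
- by rewrite gmulfM Nx // Nz // mulg1.
- by apply: moore_dense a0 R x => b; exact: res_dense.
exists x => // i le_i; apply: ev_inj => b.
apply/eqP; rewrite -subr_eq0; apply/eqP.
(* The lift is only known to lie in the closure of the Moore points. The Moore condition is closed:
   it is tested on the function b o d_i minus its value at the identity, which vanishes at all Moore
   points over k. *)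
have := x_cl (pullback (face X n i) b - (ev (X n) (1%g : pts (X n) k^o) b : k)%:A).
rewrite rmorphB /= alg_morphC -ev_hom => <- => [|x' /(_ i le_i) x'i].
  by congr (_ - _); exact: esym (mulr1 _).
by rewrite rmorphB /= alg_morphC -ev_hom x'i [_%:A]mulr1 subrr.
Qed.

Definition sphere_compat n : (nat -> pts (X n) k^o) -> Prop :=
  match n with
  | 0 => fun y => aug X k^o (y 0) = aug X k^o (y 1)
  | m.+1 => fun y => forall i j, (i <= j <= m.+1)%N ->
      face X m i k^o (y j.+1) = face X m j k^o (y i)
  end.

(** A filler w of the horn without face 0 has the wrong face 0 by a cycle. That cycle is d_0 of a
    Moore element v, and multiplication by v repairs face 0 without changing the others. *)
Lemma sphere_filler n (y : nat -> pts (X n) k^o) : sphere_compat y ->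
  exists w, forall i, (i <= n.+1)%N -> face X n i k^o w = y i.
Proof.
move=> compat; have [//||w wP] := @horn_filler k X k^o n y 0.
  by case: n y compat => //= n y compat i j le_ij _ _; exact: compat.
have [|v v_moore v0] := @moore_bound n (y 0 * (face X n 0 k^o w)^-1)%g.
  case: n y compat w wP => [|n] y compat w wP /=.
    rewrite gmulfM multiplicativeV compat -(wP 1%N) // aug_face.
    by rewrite mulgV.
  move=> i le_i; rewrite gmulfM multiplicativeV -face_face // wP //.
  by rewrite compat // mulgV.
exists (v * w)%g => -[|i] le_i; first by rewrite gmulfM v0 mulgKV.
by rewrite gmulfM v_moore // mul1g wP.
Qed.

End Resolution.

(** * Lifting of maps *)

(* Makes the value prescribed at a degenerate basis element independent of its
   expression as a degeneracy. *)
Lemma deg_common (k : fieldType) (X : simplicialGroup k) (R : comAlgType k)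
    n i j (b c : pts (X n.+1) R) : (i <= j <= n)%N ->
  deg X n.+1 i R b = deg X n.+1 j.+1 R c ->
  exists e, b = deg X n j R e /\ c = deg X n i R e.
Proof.
move=> le_ijn bc; have [le_ij le_jn] := andP le_ijn.
have c_eq : c = deg X n i R (face X n j.+1 R b).
  have := congr1 (face X n.+1 j.+2 R) bc.
  by rewrite face_deg_eqS // face_deg_gt // => [->|]; rewrite ltnS le_ij ltnS.
have b_eq : b = deg X n j R (face X n i R c).
  have := congr1 (face X n.+1 i R) bc.
  by rewrite face_deg_eq ?face_deg_lt // (leq_trans le_ij) // leqW.
exists (face X n j.+1 R b); split=> //.
by rewrite {1}b_eq c_eq face_deg_eq // (leq_trans le_ij).
Qed.

Section MapLift.
Variables (k : fieldType) (G H : prounipGroup k) (alpha : grpHom G H).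
Variables (X : freeResolution G) (Y : freeResolution H).
Hypothesis k0 : [pchar k] =i pred0.

Definition map_step n (f : grpHom (X n) (Y n)) (f' : grpHom (X n.+1) (Y n.+1)) :=
  (forall i R (x : pts (X n.+1) R), (i <= n.+1)%N ->
     f R (face X n i R x) = face Y n i R (f' R x)) /\
  (forall i R (x : pts (X n) R), (i <= n)%N ->
     f' R (deg X n i R x) = deg Y n i R (f R x)).

(** Only compatibility with one predecessor is kept: the next step takes faces of faces and common
    sources of degeneracies, and these reach no further down. *)
Definition map_good n : grpHom (X n) (Y n) -> Prop :=
  match n with
  | 0 => fun f => forall R (x : pts (X 0) R), aug Y R (f R x) = alpha R (aug X R x)
  | m.+1 => fun f => exists f0, map_step f0 f
  end.

Lemma map_good_face_deg n (f : grpHom (X n) (Y n)) R (x : pts (X n) R) i l :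
  map_good f -> (i <= n)%N -> (l <= n.+1)%N ->
  face Y n l R (deg Y n i R (f R x)) = f R (face X n l R (deg X n i R x)).
Proof.
move=> f_good le_in le_ln.
have [->|ne_li] := eqVneq l i; first by rewrite !face_deg_eq.
have [->|ne_liS] := eqVneq l i.+1; first by rewrite !face_deg_eqS.
case: n f f_good x le_in le_ln => [|n] f f_good x le_in le_ln; first by lia.
have [f0 [f0_face f0_deg]] := f_good.
have [lt_li|le_il] := ltnP l i.
  case: i le_in ne_li ne_liS lt_li => // i le_in _ _ le_li.
  by rewrite !face_deg_lt ?f0_deg -?f0_face //; lia.
case: l le_ln ne_li ne_liS le_il => [|l] le_ln ne_li ne_liS le_il; first by lia.
by rewrite !face_deg_gt ?f0_deg -?f0_face //; lia.
Qed.

Lemma map_good_deg_eq n (f : grpHom (X n) (Y n)) R (b c : pts (X n) R) i j :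
  map_good f -> (i <= n)%N -> (j <= n)%N -> deg X n i R b = deg X n j R c ->
  deg Y n i R (f R b) = deg Y n j R (f R c).
Proof.
move=> f_good; wlog le_ij : i j b c / (i <= j)%N => [IH|] le_in le_jn bc.
  by have [/IH|/ltnW/IH IH'] := leqP i j; [apply | symmetry; apply: IH'].
move: le_ij; rewrite leq_eqVlt => /predU1P[Dij|lt_ij].
  by have := congr1 (face X n i R) bc; rewrite -{}Dij !face_deg_eq // => ->.
case: n f f_good b c le_in le_jn bc => [|n] f f_good b c le_in le_jn bc; first by lia.
case: j lt_ij le_jn bc => // j le_ij le_jn bc.
have [f0 [_ f0_deg]] := f_good.
have le_ijn : (i <= j <= n)%N by lia.
have [e [-> ->]] := deg_common le_ijn bc.
rewrite f0_deg; last by lia.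
rewrite f0_deg; last by lia.
by rewrite deg_deg.
Qed.

(** At a degeneracy of a basis element the value is forced, and independent of the way of writing it
    by [map_good_deg_eq]. At any other basis element the prescribed faces form a sphere, and every
    filler will do. *)
Lemma map_good_basis n (f : grpHom (X n) (Y n)) (b' : basis X n.+1) : map_good f ->
  exists y : pts (Y n.+1) k^o,
    (forall i, (i <= n.+1)%N -> face Y n i k^o y = f k^o (face X n i k^o (gen b'))) /\
    forall i (b : basis X n), (i <= n)%N -> deg X n i k^o (gen b) = gen b' ->
      y = deg Y n i k^o (f k^o (gen b)).
Proof.
move=> f_good.
have [[i [b [le_in Db]]]|nondeg] :=
    pselect (exists i (b : basis X n), (i <= n)%N /\ deg X n i k^o (gen b) = gen b').
  exists (deg Y n i k^o (f k^o (gen b))); split=> [l le_ln|j c le_jn Dc].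
    by rewrite map_good_face_deg // Db.
  by apply: map_good_deg_eq => //; rewrite Db Dc.
have [|y yP] := @sphere_filler k H Y k0 n (fun i => f k^o (face X n i k^o (gen b'))).
  case: n f f_good b' nondeg => [|n] f f_good b' _.
    by rewrite /= !f_good aug_face.
  have [f0 [f0_face _]] := f_good => i j le_ij.
  by rewrite -!f0_face ?face_face //; lia.
exists y; split=> // i b le_in Db; case: nondeg.
by exists i, b.
Qed.

Lemma map_good_step n (f : grpHom (X n) (Y n)) : map_good f ->
  exists f', map_step f f'.
Proof.
move=> f_good; have /choice[u uP] := fun b' => map_good_basis b' f_good.
have [f' f'u] := free_hom_ex k0 (@gen_free k G X n.+1) u (pu_prounip (Y n.+1)).
exists f'; split=> i R x le_i.
  apply: (free_hom_eq k0 (@gen_free k G X n.+1)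
    (f := hom_comp f (face X n i)) (g := hom_comp (face Y n i) f')) => b /=.
  by rewrite f'u; have [-> //] := uP b.
apply: (free_hom_eq k0 (@gen_free k G X n)
  (f := hom_comp f' (deg X n i)) (g := hom_comp (deg Y n i) f)) => b /=.
have [b' Db'] := gen_deg b le_i.
by rewrite Db' f'u; have [_ uD] := uP b'; exact: uD.
Qed.

Lemma map_lift : exists f : simplicialMap X Y, map_over alpha f.
Proof.
have /choice[u uP] (b : basis X 0) : exists y : pts (Y 0) k^o,
    aug Y k^o y = alpha k^o (aug X k^o (gen b)) by exact: aug_surj.
have [f0 f0u] := free_hom_ex k0 (@gen_free k G X 0) u (pu_prounip (Y 0)).
have f0_good : @map_good 0 f0.
  move=> R x; apply: (free_hom_eq k0 (@gen_free k G X 0)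
    (f := hom_comp (aug Y) f0) (g := hom_comp alpha (aug X))) => b /=.
  by rewrite f0u uP.
pose T n := {f : grpHom (X n) (Y n) | map_good f}.
have next n (f : T n) : {f' : T n.+1 | map_step (sval f) (sval f')}.
  apply: cid; have [f' ff'] := map_good_step (svalP f).
  have f'_good : @map_good n.+1 f' by exists (sval f).
  by exists (exist _ f' f'_good).
pose F := nat_rect T (exist _ f0 f0_good) (fun n f => sval (next n f)).
have FP n : map_step (sval (F n)) (sval (F n.+1)) by exact: (svalP (next n (F n))).
have F_face n i R (x : pts (X n.+1) R) : (i <= n.+1)%N ->
    sval (F n) R (face X n i R x) = face Y n i R (sval (F n.+1) R x).
  by have [Ff _] := FP n; exact: Ff.
have F_deg n i R (x : pts (X n) R) : (i <= n)%N ->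
    sval (F n.+1) R (deg X n i R x) = deg Y n i R (sval (F n) R x).
  by have [_ Fd] := FP n; exact: Fd.
by exists (@SimplicialMap k X Y (fun n => sval (F n)) F_face F_deg).
Qed.

End MapLift.

(** * Homotopies *)

Section HomotopyLift.
Variables (k : fieldType) (G H : prounipGroup k) (alpha : grpHom G H).
Variables (X : freeResolution G) (Y : freeResolution H).
Variables f g : simplicialMap X Y.
Hypothesis k0 : [pchar k] =i pred0.
Hypotheses (f_over : map_over alpha f) (g_over : map_over alpha g).

Definition htp_inner n (h : nat -> grpHom (X n) (Y n.+1)) : Prop :=
  [/\ forall R (x : pts (X n) R), face Y n 0 R (h 0 R x) = f n R x,
      forall R (x : pts (X n) R), face Y n n.+1 R (h n R x) = g n R x
    & forall j R (x : pts (X n) R), (j < n)%N ->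
        face Y n j.+1 R (h j.+1 R x) = face Y n j.+1 R (h j R x)].

Definition htp_step n (h : nat -> grpHom (X n) (Y n.+1))
    (h' : nat -> grpHom (X n.+1) (Y n.+2)) : Prop :=
  [/\ forall i j R (x : pts (X n.+1) R), (i <= j <= n)%N ->
        face Y n.+1 i R (h' j.+1 R x) = h j R (face X n i R x),
      forall i j R (x : pts (X n.+1) R), (j < i <= n.+1)%N ->
        face Y n.+1 i.+1 R (h' j R x) = h j R (face X n i R x),
      forall i j R (x : pts (X n) R), (i <= j <= n)%N ->
        deg Y n.+1 i R (h j R x) = h' j.+1 R (deg X n i R x)
    & forall i j R (x : pts (X n) R), (j <= i <= n)%N ->
        deg Y n.+1 i.+1 R (h j R x) = h' j R (deg X n i R x)].

Definition htp_good n : (nat -> grpHom (X n) (Y n.+1)) -> Prop :=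
  match n with
  | 0 => fun h => htp_inner h
  | m.+1 => fun h => htp_inner h /\ exists h0, htp_inner h0 /\ htp_step h0 h
  end.

Lemma htp_good_inner n h : @htp_good n h -> htp_inner h.
Proof. by case: n h => [|n] h // []. Qed.

(* Degeneracies of the path object of Y, whose n-simplices are sequences
   e_0, ..., e_n in Y_{n+1}; they dictate a homotopy on degenerate simplices. *)
Definition path_deg n (i : nat) (e : nat -> pts (Y n) k^o) (j : nat) : pts (Y n.+1) k^o :=
  if (i < j)%N then deg Y n i k^o (e j.-1) else deg Y n i.+1 k^o (e j).

Lemma path_degC n i i' j (e : nat -> pts (Y n.+1) k^o) :
  (i <= i' <= n)%N -> (j <= n.+2)%N ->
  path_deg i (path_deg i' e) j = path_deg i'.+1 (path_deg i e) j.
Proof.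
move=> le_i le_j; rewrite /path_deg.
case: j le_j => [|j] le_j; first by rewrite !ltn0 deg_deg //; lia.
by do !case: ltnP => ? /=; first [lia | rewrite deg_deg //; lia].
Qed.

Lemma path_deg_ext n i (e e' : nat -> pts (Y n.+1) k^o) j :
  (i <= n)%N -> (j <= n.+1)%N -> (forall l, (l <= n)%N -> e l = e' l) ->
  path_deg i e j = path_deg i e' j.
Proof.
by move=> le_in le_jn ee; rewrite /path_deg; case: ltnP => lt_ij; rewrite ee //; lia.
Qed.

(* The values (e_0, ..., e_{n+1}) of the homotopy at x, given the homotopy h on
   the simplices of dimension n. *)
Definition htp_value n (h : nat -> pts (X n) k^o -> pts (Y n.+1) k^o)
    (x : pts (X n.+1) k^o) (j : nat) (e : nat -> pts (Y n.+2) k^o) : Prop :=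
  [/\ (j = 0%N -> face Y n.+1 0 k^o (e 0%N) = f n.+1 k^o x),
      (j = n.+1 -> face Y n.+1 n.+2 k^o (e n.+1) = g n.+1 k^o x),
      forall j', j = j'.+1 -> face Y n.+1 j k^o (e j) = face Y n.+1 j k^o (e j'),
      forall i j', j = j'.+1 -> (i < j)%N ->
        face Y n.+1 i k^o (e j) = h j' (face X n i k^o x)
    & forall i, (j < i <= n.+1)%N -> face Y n.+1 i.+1 k^o (e j) = h j (face X n i k^o x)].

(** The values forced on a degenerate simplex satisfy the conditions imposed on freely chosen ones.
    A face next to the degeneracy cancels it; otherwise the two commute and the identities satisfied
    by h apply. *)
Lemma htp_value_deg n (h : nat -> grpHom (X n) (Y n.+1)) (b : pts (X n) k^o) i j :
  htp_good h -> (i <= n)%N -> (j <= n.+1)%N ->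
  htp_value (fun l => h l k^o) (deg X n i k^o b) j (path_deg i (fun l => h l k^o b)).
Proof.
move=> h_good le_in le_jn; have [h_f h_g h_eq] := htp_good_inner h_good.
split.
- by move=> _; rewrite /path_deg ltn0 face_deg_lt // h_f map_deg.
- move=> _; rewrite /path_deg ltnS le_in face_deg_gt ?h_g ?map_deg //.
  by rewrite ltnS le_in /=.
- move=> j' Dj; rewrite Dj in le_jn *; rewrite /path_deg ltnS /=.
  have [lt_ij|lt_ji|->] := ltngtP i j'.
  + case: j' lt_ij le_jn {Dj} => // j' le_ij le_jn.
    by rewrite /= !face_deg_gt ?h_eq //; lia.
  + by case: i lt_ji le_in => // i lt_ji le_in; rewrite !face_deg_lt ?h_eq //; lia.
  + by rewrite face_deg_eqS ?face_deg_eq //; lia.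
- move=> l j' Dj lt_lj; rewrite Dj in le_jn lt_lj *; rewrite /path_deg ltnS /=.
  have [le_ij|lt_ji] := leqP i j'.
    have [->|ne_li] := eqVneq l i; first by rewrite !face_deg_eq //; lia.
    have [->|ne_liS] := eqVneq l i.+1; first by rewrite !face_deg_eqS //; lia.
    case: n h h_good b h_f h_g h_eq le_in le_jn =>
      [|n] h h_good b h_f h_g h_eq le_in le_jn; first by lia.
    have [_ [h0 [_ [h0f h0f' h0d h0d']]]] := h_good.
    have [lt_li|le_il] := ltnP l i.
      case: i le_in le_ij ne_li ne_liS lt_li => // i le_in le_ij _ _ le_li.
      case: j' Dj lt_lj le_jn le_ij => // j' Dj lt_lj le_jn le_ij.
      by rewrite !face_deg_lt ?h0f ?h0d //; lia.
    case: l lt_lj ne_li ne_liS le_il => [|l] lt_lj ne_li ne_liS le_il; first by lia.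
    case: j' Dj lt_lj le_jn le_ij => [|j'] Dj lt_lj le_jn le_ij; first by lia.
    by rewrite !face_deg_gt ?h0f ?h0d //; lia.
  case: n h h_good b h_f h_g h_eq le_in le_jn =>
      [|n] h h_good b h_f h_g h_eq le_in le_jn; first by lia.
  have [_ [h0 [_ [h0f h0f' h0d h0d']]]] := h_good.
  case: i le_in lt_ji => // i le_in lt_ji.
  by rewrite !face_deg_lt ?h0f ?h0d' //; lia.
- move=> l le_l; rewrite /path_deg.
  have [lt_ij|le_ji] := ltnP i j.
    case: n h h_good b h_f h_g h_eq le_in le_jn le_l =>
      [|n] h h_good b h_f h_g h_eq le_in le_jn le_l; first by lia.
    have [_ [h0 [_ [h0f h0f' h0d h0d']]]] := h_good.
    case: j lt_ij le_jn le_l => // j lt_ij le_jn le_l.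
    case: l le_l => // l le_l /=.
    by rewrite !face_deg_gt ?h0f' ?h0d //; lia.
  have [->|ne_li] := eqVneq l i; first by rewrite !face_deg_eq //; lia.
  have [->|ne_liS] := eqVneq l i.+1; first by rewrite !face_deg_eqS //; lia.
  case: n h h_good b h_f h_g h_eq le_in le_jn le_l =>
      [|n] h h_good b h_f h_g h_eq le_in le_jn le_l; first by lia.
  have [_ [h0 [_ [h0f h0f' h0d h0d']]]] := h_good.
  have [lt_li|le_il] := ltnP l i.
    case: i le_in le_ji ne_li ne_liS lt_li => // i le_in le_ji _ _ le_li.
    by rewrite !face_deg_lt ?h0f' ?h0d' //; lia.
  case: l le_l ne_li ne_liS le_il => // l le_l ne_li ne_liS le_il.
  by rewrite !face_deg_gt ?h0f' ?h0d' //; lia.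
Qed.

(** For i < i' both expressions come from a common e by [deg_common]. There h is itself given by
    degeneracies of the path object, and the claim becomes their commutation. *)
Lemma path_deg_eq n (h : nat -> grpHom (X n) (Y n.+1)) (b c : pts (X n) k^o) i i' j :
  htp_good h -> (i <= n)%N -> (i' <= n)%N -> (j <= n.+1)%N ->
  deg X n i k^o b = deg X n i' k^o c ->
  path_deg i (fun l => h l k^o b) j = path_deg i' (fun l => h l k^o c) j.
Proof.
move=> h_good; wlog le_ii : i i' b c / (i <= i')%N => [IH|] le_in le_in' le_j bc.
  by have [/IH|/ltnW/IH IH'] := leqP i i'; [apply | symmetry; apply: IH'].
move: le_ii; rewrite leq_eqVlt => /predU1P[Dii|lt_ii].
  by have := congr1 (face X n i k^o) bc; rewrite -{}Dii !face_deg_eq // => ->.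
case: n h h_good b c le_in le_in' le_j bc => [|n] h h_good b c le_in le_in' le_j bc; first by lia.
case: i' lt_ii le_in' bc => // i' le_ii le_in' bc.
have [_ [h0 [_ [_ _ h0d h0d']]]] := h_good.
have le_iin : (i <= i' <= n)%N by lia.
have [e [-> ->]] := deg_common le_iin bc.
have hE a l : (a <= n)%N -> (l <= n.+1)%N ->
    h l k^o (deg X n a k^o e) = path_deg a (fun m => h0 m k^o e) l.
  move=> le_an le_ln; rewrite /path_deg; case: ltnP => [lt_al|le_la].
    by case: l le_ln lt_al => // l le_ln lt_al; rewrite h0d //; lia.
  by rewrite h0d' //; lia.
rewrite (@path_deg_ext _ _ _ (path_deg i' (fun m => h0 m k^o e))) => [|//|//|l le_l].
  rewrite path_degC // (@path_deg_ext _ i'.+1 _ (path_deg i (fun m => h0 m k^o e))) // => l le_l.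
  by rewrite hE //; lia.
by rewrite hE //; lia.
Qed.


(** This and the next two lemmas match the faces that h prescribes for the sphere in
    [htp_value_fill]: both face indices below the level, on either side of it, or both above. *)
Lemma htp_good_face_lt n (h : nat -> grpHom (X n) (Y n.+1)) (x : pts (X n.+1) k^o) i j l :
  htp_good h -> (i <= j <= l)%N -> (l < n)%N ->
  face Y n i k^o (h l.+1 k^o (face X n j.+1 k^o x)) =
  face Y n j k^o (h l.+1 k^o (face X n i k^o x)).
Proof.
case: n h x => // n h x [_ [h0 [_ [h0_lt _ _ _]]]] le_ij lt_ln.
by rewrite !h0_lt ?face_face //; lia.
Qed.

Lemma htp_good_face_mid n (h : nat -> grpHom (X n) (Y n.+1)) (x : pts (X n.+1) k^o) i j l :
  htp_good h -> (i <= l)%N -> (l.+1 < j <= n.+1)%N ->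
  face Y n i k^o (h l.+1 k^o (face X n j k^o x)) =
  face Y n j k^o (h l k^o (face X n i k^o x)).
Proof.
case: n h x => [|n] h x; first by lia.
case: j => // j [_ [h0 [_ [h0_lt h0_gt _ _]]]] le_il lt_lj.
by rewrite h0_lt ?h0_gt ?face_face //; lia.
Qed.

Lemma htp_good_face_gt n (h : nat -> grpHom (X n) (Y n.+1)) (x : pts (X n.+1) k^o) i j l :
  htp_good h -> (l < i)%N -> (i < j <= n.+1)%N ->
  face Y n i.+1 k^o (h l k^o (face X n j k^o x)) =
  face Y n j k^o (h l k^o (face X n i k^o x)).
Proof.
case: n h x => [|n] h x; first by lia.
case: j => // j [_ [h0 [_ [_ h0_gt _ _]]]] lt_li le_ij.
by rewrite !h0_gt ?face_face //; lia.
Qed.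

(* The value e_t is found by filling a sphere with one face missing (none when t
   is maximal); P is the face it shares with e_{t-1}. *)
Lemma htp_value_fill n (h : nat -> grpHom (X n) (Y n.+1)) (x : pts (X n.+1) k^o) :
  htp_good h -> exists e, forall j, (j <= n.+1)%N ->
    htp_value (fun l => h l k^o) x j e.
Proof.
move=> h_good; have [h_f h_g h_eq] := htp_good_inner h_good.
suff /(_ n.+2 (leqnn _)) [e eP] : forall t, (t <= n.+2)%N -> exists e,
    forall j, (j < t)%N -> htp_value (fun l => h l k^o) x j e.
  by exists e => j le_j; apply: eP.
elim=> [|t IHt] le_t; first by exists (fun=> 1%g).
have [|e eP] := IHt; first exact: ltnW.
pose P : pts (Y n.+1) k^o :=
  if t is t'.+1 then face Y n.+1 t k^o (e t') else f n.+1 k^o x.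
(* The boundary of [P] has to fit the other prescribed faces: P2 concerns its faces from t on, P3
   the last one when t = n.+1, and P1 those below t. *)
have P2 j : (t <= j <= n.+1)%N -> (t <= n)%N ->
    face Y n j k^o P = face Y n t k^o (h t k^o (face X n j k^o x)).
  move=> le_tj le_tn; rewrite /P; case: t eP le_tj le_tn {P IHt le_t} => [|t] eP le_tj le_tn.
    by rewrite h_f -map_face.
  have [_ _ _ _ e_gt] := eP t (ltnSn t).
  have le_tjn : (t.+1 <= j <= n.+1)%N by lia.
  by rewrite -face_face // e_gt // h_eq.
have P3 : t = n.+1 -> face Y n n.+1 k^o P = g n k^o (face X n n.+1 k^o x).
  rewrite /P; case: t eP {P P2 IHt le_t} => // t eP [Dt]; subst t.
  have [_ _ _ _ e_gt] := eP n (ltnSn n).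
  have le_nn : (n.+1 <= n.+1 <= n.+1)%N by lia.
  by rewrite -face_face // e_gt ?h_g //; lia.
have P1 i t' : t = t'.+1 -> (i < t)%N ->
    face Y n i k^o P = face Y n t' k^o (h t' k^o (face X n i k^o x)).
  move=> Dt lt_it; subst t; rewrite /P.
  have [e0 _ e_eq e_lt e_gt] := eP t' (ltnSn t').
  have le_it : (i <= t' <= n.+1)%N by lia.
  rewrite face_face //; have [lt_it'|le_ti] := ltnP i t'.
    case: t' e_lt lt_it' le_t {P P2 P3 lt_it e_eq e_gt e0 eP IHt le_it} => // t' e_lt lt_it' le_t.
    by rewrite (e_lt i t') // h_eq //; lia.
  (* In this corner the face of e_t' is again a shared one, so the argument goes back to the
     component before it, or to f if there is none. *)
  have {le_it le_ti lt_it} -> : i = t' by lia.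
  case: t' e0 e_eq le_t eP {P P2 P3 e_lt e_gt IHt} => [|t'] e0 e_eq le_t eP.
    by rewrite e0 // h_f map_face.
  have [_ _ _ _ e_gt] := eP t' (leqnSn _).
  have le_tt : (t'.+1 <= t'.+1 <= n.+1)%N by lia.
  rewrite (e_eq t') // -face_face // e_gt; last by lia.
  by rewrite h_eq //; lia.
(* Face t.+1 of e_t will be shared with the next component and is left open; the value of y there is
   a dummy unless t = n.+1, when it is the prescribed end g. *)
pose y i := if (i < t)%N then h t.-1 k^o (face X n i k^o x) else
  if i == t then P else
  if (i == t.+1) && (t == n.+1) then g n.+1 k^o x else h t k^o (face X n i.-1 k^o x).
have y_lt i : (i < t)%N -> y i = h t.-1 k^o (face X n i k^o x) by rewrite /y => ->.
have y_eq : y t = P by rewrite /y ltnn eqxx.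
have y_gt i : (t < i)%N -> y i.+1 = h t k^o (face X n i k^o x).
  move=> lt_ti; rewrite /y; case: ltnP => [?|_]; first by lia.
  by case: eqP => [?|_]; [lia|case: eqP => [?|_] //; lia].
have y_last : t = n.+1 -> y t.+1 = g n.+1 k^o x.
  move=> Dt; rewrite /y; case: ltnP => [?|_]; first by lia.
  by case: eqP => [?|_]; [lia|rewrite eqxx /= [t == _](introT eqP Dt)].
have {y_lt y_eq y_gt y_last} [y_lt y_eq y_gt y_last] := And4 y_lt y_eq y_gt y_last.
move: y y_lt y_eq y_gt y_last => y y_lt y_eq y_gt y_last.
have compat i j : (i <= j <= n.+1)%N -> (t == n.+1) || (i != t.+1) && (j != t) ->
    face Y n i k^o (y j.+1) = face Y n j k^o (y i).
  move=> le_ij ne_t; have [lt_it|lt_ti|Dit] := ltngtP i t.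
  - rewrite (y_lt i) //; have [lt_jt|lt_tj|Djt] := ltngtP j.+1 t.
    + rewrite y_lt //; case: (t) le_t lt_it lt_jt => [|[|l]] // le_t lt_it lt_jt.
      by rewrite htp_good_face_lt //; lia.
    + have [Djt|ne_jt] := eqVneq j t.
        have Dt : t = n.+1 by move: ne_t; rewrite Djt eqxx andbF orbF => /eqP.
        rewrite Djt y_last // -map_face; last by lia.
        by rewrite Dt /= h_g.
      rewrite y_gt; last by lia.
      case: (t) le_t lt_it lt_tj ne_jt => // l le_t lt_it lt_tj ne_jt.
      by rewrite htp_good_face_mid //; lia.
    + by rewrite Djt y_eq (P1 i j) // -Djt.
  - have ne_tSi : i != t.+1.
      by case/orP: ne_t => [/eqP Dt|/andP[-> //]]; lia.
    case: i {ne_t} le_ij lt_ti ne_tSi => // i le_ij lt_ti ne_tSi.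
    by rewrite !y_gt ?htp_good_face_gt //; lia.
  rewrite Dit y_eq; have [Djt|ne_jt] := eqVneq j t.
    have Dt : t = n.+1 by move: ne_t; rewrite Djt eqxx andbF orbF => /eqP.
    by rewrite Djt y_last // Dt P3 // map_face.
  by rewrite y_gt ?P2 //; lia.
have [w wP] : exists w, forall i, (i <= n.+2)%N -> (t == n.+1) || (i != t.+1) ->
    face Y n.+1 i k^o w = y i.
  have [Dt|ne_t] := eqVneq t n.+1.
    have [|w wP] := @sphere_filler k H Y k0 n.+1 y.
      by move=> i j le_ij; apply: compat; rewrite ?Dt ?eqxx.
    by exists w => i le_i _; apply: wP.
  have [||w wP] := @horn_filler k Y k^o n.+1 y t.+1; first by lia.
    by move=> i j le_ij ne_i ne_j; apply: compat; rewrite // ne_i ne_j orbT.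
  by exists w.
exists (fun j => if j == t then w else e j) => j; rewrite ltnS leq_eqVlt.
case/predU1P=> [->|lt_jt]; last first.
  have ne_j l : (l <= j)%N -> (l == t) = false by lia.
  have [e0 en e_eq e_lt e_gt] := eP j lt_jt; split=> [j0|jn|j' Dj|i j' Dj lt_ij|i le_i].
  - by rewrite ne_j // e0.
  - by rewrite ne_j ?en // jn.
  - by rewrite !ne_j ?(e_eq j' Dj) //; lia.
  - by rewrite ne_j // (e_lt i j').
  - by rewrite ne_j // e_gt.
split.
- move=> t0; rewrite [0%N == t](introT eqP (esym t0)) wP ?orbT //.
  have -> : y 0%N = y t by rewrite t0.
  by rewrite y_eq /P t0.
- move=> tn; rewrite [n.+1 == t](introT eqP (esym tn)).
  rewrite wP ?(introT eqP tn) //.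
  have -> : y n.+2 = y t.+1 by rewrite tn.
  by rewrite y_last.
- move=> t' Dt; rewrite eqxx [t' == t]ltn_eqF ?Dt // -Dt wP; try lia.
  by rewrite y_eq /P; case: (t) Dt => // ? [->].
- move=> i t' Dt lt_it; rewrite eqxx wP ?y_lt ?Dt //; try lia.
move=> i le_i; rewrite eqxx wP ?y_gt //; lia.
Qed.

End HomotopyLift.

Section HomotopyExists.
Variables (k : fieldType) (G H : prounipGroup k) (alpha : grpHom G H).
Variables (X : freeResolution G) (Y : freeResolution H).
Variables f g : simplicialMap X Y.
Hypothesis k0 : [pchar k] =i pred0.
Hypotheses (f_over : map_over alpha f) (g_over : map_over alpha g).

Lemma htp_basis n (h : nat -> grpHom (X n) (Y n.+1)) (b' : basis X n.+1) :
  htp_good f g h -> exists e : nat -> pts (Y n.+2) k^o,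
    (forall j, (j <= n.+1)%N -> htp_value f g (fun l => h l k^o) (gen b') j e) /\
    forall i (b : basis X n) j, (i <= n)%N -> (j <= n.+1)%N ->
      deg X n i k^o (gen b) = gen b' -> e j = path_deg i (fun l => h l k^o (gen b)) j.
Proof.
move=> h_good.
have [[i [b [le_in Db]]]|nondeg] :=
    pselect (exists i (b : basis X n), (i <= n)%N /\ deg X n i k^o (gen b) = gen b').
  exists (path_deg i (fun l => h l k^o (gen b))); split=> [j le_j|i' c j le_i' le_j Dc].
    by rewrite -Db; exact: htp_value_deg.
  by apply: (path_deg_eq h_good) => //; rewrite Db Dc.
have [e eP] := htp_value_fill k0 (gen b') h_good.
exists e; split=> // i b j le_i _ Db; case: nondeg.
by exists i, b.
Qed.

Lemma htp_next n (h : nat -> grpHom (X n) (Y n.+1)) : htp_good f g h ->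
  exists h', htp_inner f g h' /\ htp_step h h'.
Proof.
move=> h_good; have /choice[u uP] := fun b' => htp_basis b' h_good.
have /choice[h' h'u] j : exists h' : grpHom (X n.+1) (Y n.+2),
    forall b', h' k^o (gen b') = u b' j.
  exact: (free_hom_ex k0 (@gen_free k G X n.+1) (fun b' => u b' j) (pu_prounip _)).
have u_val b' j : (j <= n.+1)%N -> htp_value f g (fun l => h l k^o) (gen b') j (u b').
  by have [+ _] := uP b'; apply.
exists h'; split; split.
- move=> R x; apply: (free_hom_eq k0 (@gen_free k G X n.+1)
    (f := hom_comp (face Y n.+1 0) (h' 0%N)) (g := f n.+1)) => b /=.
  by rewrite h'u; have [-> //] := u_val b 0%N (leq0n _).
- move=> R x; apply: (free_hom_eq k0 (@gen_free k G X n.+1)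
    (f := hom_comp (face Y n.+1 n.+2) (h' n.+1)) (g := g n.+1)) => b /=.
  by rewrite h'u; have [_ -> //] := u_val b n.+1 (leqnn _).
- move=> j R x lt_j; apply: (free_hom_eq k0 (@gen_free k G X n.+1)
    (f := hom_comp (face Y n.+1 j.+1) (h' j.+1))
    (g := hom_comp (face Y n.+1 j.+1) (h' j))) => b /=.
  by rewrite !h'u; have [_ _ /(_ j erefl)] := u_val b j.+1 lt_j.
- move=> i j R x le_ij; apply: (free_hom_eq k0 (@gen_free k G X n.+1)
    (f := hom_comp (face Y n.+1 i) (h' j.+1))
    (g := hom_comp (h j) (face X n i))) => b /=.
  have le_j : (j.+1 <= n.+1)%N by lia.
  by rewrite h'u; have [_ _ _ /(_ i j erefl) -> //] := u_val b j.+1 le_j; lia.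
- move=> i j R x le_ij; apply: (free_hom_eq k0 (@gen_free k G X n.+1)
    (f := hom_comp (face Y n.+1 i.+1) (h' j))
    (g := hom_comp (h j) (face X n i))) => b /=.
  have le_j : (j <= n.+1)%N by lia.
  by rewrite h'u; have [_ _ _ _ ->] := u_val b j le_j.
- move=> i j R x le_ij; apply: (free_hom_eq k0 (@gen_free k G X n)
    (f := hom_comp (deg Y n.+1 i) (h j))
    (g := hom_comp (h' j.+1) (deg X n i))) => b /=.
  have le_i : (i <= n)%N by lia.
  have [b' Db'] := gen_deg b le_i.
  have [_ /(_ i b j.+1 le_i) uD] := uP b'.
  rewrite Db' h'u uD //; last by lia.
  by rewrite /path_deg ifT //; lia.
- move=> i j R x le_ij; apply: (free_hom_eq k0 (@gen_free k G X n)
    (f := hom_comp (deg Y n.+1 i.+1) (h j))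
    (g := hom_comp (h' j) (deg X n i))) => b /=.
  have le_i : (i <= n)%N by lia.
  have [b' Db'] := gen_deg b le_i.
  have [_ /(_ i b j le_i) uD] := uP b'.
  rewrite Db' h'u uD //; last by lia.
  by rewrite /path_deg ifF //; lia.
Qed.

Lemma htp_start : exists h : nat -> grpHom (X 0) (Y 1), htp_good f g h.
Proof.
have /choice[u uP] (b : basis X 0) : exists y : pts (Y 1) k^o,
    face Y 0 0 k^o y = f 0%N k^o (gen b) /\ face Y 0 1 k^o y = g 0%N k^o (gen b).
  pose y i := if i is 0 then f 0%N k^o (gen b) else g 0%N k^o (gen b).
  have [|w wP] := @sphere_filler k H Y k0 0 y; first by rewrite /= f_over g_over.
  by exists w; rewrite !wP.
have [h0 h0u] := free_hom_ex k0 (@gen_free k G X 0) u (pu_prounip (Y 1)).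
exists (fun=> h0); split=> // R x.
  apply: (free_hom_eq k0 (@gen_free k G X 0)
    (f := hom_comp (face Y 0 0) h0) (g := f 0%N)) => b /=.
  by rewrite h0u; have [] := uP b.
apply: (free_hom_eq k0 (@gen_free k G X 0)
    (f := hom_comp (face Y 0 1) h0) (g := g 0%N)) => b /=.
by rewrite h0u; have [] := uP b.
Qed.

Lemma augn_face n i R (y : pts (Y n.+1) R) : (i <= n.+1)%N ->
  augn Y n R (face Y n i R y) = augn Y n.+1 R y.
Proof.
elim: n i y => [|n IHn] [|i] y le_i //=.
  by case: i le_i => // _; rewrite aug_face.
by rewrite -[augn Y n R (face Y n 0 R _)]/(augn Y n.+1 R _) /= face_face // IHn.
Qed.

Lemma map_over_augn n R (x : pts (X n) R) :
  augn Y n R (f n R x) = alpha R (augn X n R x).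
Proof.
elim: n x => [|n IHn] x; first exact: f_over.
by rewrite /= -map_face.
Qed.

Lemma homotopy_exists : homotopic_over alpha f g.
Proof.
have [h0 h0_good] := htp_start.
pose T n := {h : nat -> grpHom (X n) (Y n.+1) | htp_good f g h}.
have next n (h : T n) : {h' : T n.+1 | htp_step (sval h) (sval h')}.
  apply: cid; have [h' [h'_inner hh']] := htp_next (svalP h).
  have h'_good : @htp_good k G H X Y f g n.+1 h'.
    split=> //; exists (sval h); split=> //.
    exact: htp_good_inner (svalP h).
  by exists (exist _ h' h'_good).
pose F := nat_rect T (exist _ h0 h0_good) (fun n h => sval (next n h)).
have F_step n : htp_step (sval (F n)) (sval (F n.+1)) by exact: (svalP (next n (F n))).
have F_inner n : htp_inner f g (sval (F n)) by exact: htp_good_inner (svalP (F n)).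
exists (fun n => sval (F n)); split.
- by move=> n R x; have [] := F_inner n.
- by move=> n R x; have [_ -> _] := F_inner n.
- split=> [n i j R x le_i|n j R x lt_j|n i j R x lt_j].
  + by have [-> // _ _ _] := F_step n.
  + by have [_ _ ->] := F_inner n.
  + by have [_ -> // _ _] := F_step n.
- split=> n i j R x le_i.
  + by have [_ _ -> // _] := F_step n.
  + by have [_ _ _ ->] := F_step n.
move=> n i R x le_i; have [F_f _ F_eq] := F_inner n.
(* The augmentation can be read off any face. Consecutive components share a face, so the claim
   passes from h n 0, whose face 0 is f, to all i. *)
elim: i le_i => [|i IHi] le_i.
  by rewrite -(@augn_face n 0) // F_f map_over_augn.
by rewrite -(@augn_face n i.+1) ?F_eq ?augn_face ?IHi //; lia.
Qed.

End HomotopyExists.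

Theorem proposition3p7 (k : fieldType) (hk : [pchar k] =i pred0) :
  (forall (G H : prounipGroup k) (X : freeResolution G) (Y : freeResolution H)
          (alpha : grpHom G H),
     (exists f : simplicialMap X Y, map_over alpha f) /\
     (forall f g : simplicialMap X Y,
        map_over alpha f -> map_over alpha g -> homotopic_over alpha f g)) /\
  (forall (G : prounipGroup k) (X Y : freeResolution G),
     homotopy_equivalent_over X Y).
Proof.
split=> [G H X Y alpha|G X Y].
  split; first exact: map_lift.
  by move=> f g f_over g_over; exact: homotopy_exists.
have [f f_over] := map_lift (hom_id G) X Y hk.
have [g g_over] := map_lift (hom_id G) Y X hk.
exists f, g; split=> //; apply: homotopy_exists => // R x /=.
  by rewrite g_over /= f_over.
by rewrite f_over /= g_over.
Qed.
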